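(* Let $m,n\in\mathbb{N}$ (positive integers), $\alpha\in(0,2)$ and $c\in\mathbb{R}$. Suppose $f\in L^1(\mathbb{R})\cap L^\infty(\mathbb{R})$ is compactly supported and $u(x,t)=f(x-ct)$ is a solution of $$\partial_t u+\partial_x(u^m)-\partial_x(-\Delta)^{\frac{\alpha}{2}}(u^n)=0,\qquad x\in\mathbb{R},\ t\in\mathbb{R}.$$ Then $f=0$ (almost everywhere).
   Context: $(-\Delta)^{\alpha/2}$ is the Riesz derivative on $\mathbb{R}$ in the variable $x$, defined by the Fourier transform: $\mathcal{F}[(-\Delta)^{\alpha/2}g](\xi)=|\xi|^\alpha\mathcal{F}[g](\xi)$, $\xi\in\mathbb{R}$. Since $f$ is only assumed integrable, bounded and compactly supported, the equation is understood in the sense of (tempered) distributions. *)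

(* Defs.v *)
From HB Require Import structures.
From mathcomp Require Export all_boot all_order all_algebra.
From mathcomp Require Export all_classical all_reals all_analysis.
From mathcomp Require Export complex.

Set Implicit Arguments.
Unset Strict Implicit.
Unset Printing Implicit Defensive.

Import Order.TTheory GRing.Theory Num.Theory.
Import numFieldNormedType.Exports.

Local Open Scope classical_set_scope.
Local Open Scope ring_scope.
Local Open Scope complex_scope.

Section definitions.
Context {R : realType}.

Local Notation C := R[i].
Local Notation mu := (@lebesgue_measure R).

(* Points of the plane are pairs (x, t), or (xi, t) on the Fourier side. *)
Local Notation plane := (R * R)%type.

Definition cintegral (d : measure_display) (T : measurableType d)
    (nu : {measure set T -> \bar R}) (g : T -> C) : C :=
  (\int[nu]_x complex.Re (g x))%R +i* (\int[nu]_x complex.Im (g x))%R.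

(* F[g](xi) = \int g(x) e^{-i x xi} dx, the normalization for which - d^2/dx^2
   has symbol |xi|^2. *)
Definition fourier (g : R -> C) (xi : R) : C :=
  cintegral mu (fun x => g x * (cos (x * xi) -i* sin (x * xi))).

Definition fourier_x (phi : plane -> C) (z : plane) : C :=
  fourier (fun x => phi (x, z.2)) z.1.

Definition partial (v : plane) (phi : plane -> C) (z : plane) : C :=
  'D_v (@complex.Re R \o phi) z +i* 'D_v (@complex.Im R \o phi) z.

Definition d_x : (plane -> C) -> plane -> C := partial (1, 0).
Definition d_t : (plane -> C) -> plane -> C := partial (0, 1).

(* Every partial derivative of every order, taken in any order (true = d_x,
   false = d_t), exists and is Frechet differentiable, hence continuous. *)
Definition smooth (phi : plane -> C) : Prop :=
  forall (w : seq bool) (z : plane),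
    let psi := foldr (fun b : bool => if b then d_x else d_t) phi w in
    differentiable (@complex.Re R \o psi) z /\
    differentiable (@complex.Im R \o psi) z.

Definition seminorm_le (i j a b : nat) (phi : plane -> C) (M : R) : Prop :=
  forall z : plane,
    `|z.1| ^+ i * `|z.2| ^+ j * Normc.normc (iter a d_x (iter b d_t phi) z) <= M.

Definition schwartz (phi : plane -> C) : Prop :=
  smooth phi /\ forall i j a b : nat, exists M : R, seminorm_le i j a b phi M.

(* A distribution is a total function on plane -> C of which only the values
   on Schwartz functions matter; continuity is the usual domination by finitely
   many of the seminorms defining the topology of the Schwartz space. *)
Definition tempered (T : (plane -> C) -> C) : Prop :=
  (forall (a : C) (phi psi : plane -> C), schwartz phi -> schwartz psi ->
     T (fun z => a * phi z + psi z) = a * T phi + T psi) /\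
  exists (N : nat) (K : R), forall (phi : plane -> C) (M : R), schwartz phi ->
    (forall i j a b : nat, (i <= N)%N -> (j <= N)%N -> (a <= N)%N ->
       (b <= N)%N -> seminorm_le i j a b phi M) ->
    Normc.normc (T phi) <= K * M.

Definition dist_of (v : plane -> C) (phi : plane -> C) : C :=
  cintegral (mu \x mu)%E (fun z => v z * phi z).

Definition dist_dx (T : (plane -> C) -> C) (phi : plane -> C) : C :=
  - T (d_x phi).
Definition dist_dt (T : (plane -> C) -> C) (phi : plane -> C) : C :=
  - T (d_t phi).
Definition dist_fourier_x (T : (plane -> C) -> C) (phi : plane -> C) : C :=
  T (fourier_x phi).

(* T = (-Delta)^{alpha/2} v, in the variable x: F_x[T] = |xi|^alpha F_x[v] as
   tempered distributions. The right-hand side is read as a function of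
   (xi, t), so this is meant for v integrable in x for each t. T is unique on
   Schwartz functions, as F_x is a bijection of the Schwartz space. *)
Definition is_riesz_derivative (alpha : R) (v : plane -> C)
    (T : (plane -> C) -> C) : Prop :=
  tempered T /\
  forall phi : plane -> C, schwartz phi ->
    dist_fourier_x T phi =
    dist_of (fun z => (`|z.1| `^ alpha)%:C * fourier_x v z) phi.

(* d_t u + d_x (u^m) - d_x (-Delta)^{alpha/2} (u^n) = 0 in S'(R^2). *)
Definition is_solution (m n : nat) (alpha : R) (u : plane -> R) : Prop :=
  exists T : (plane -> C) -> C,
    is_riesz_derivative alpha (fun z => (u z ^+ n)%:C) T /\
    forall phi : plane -> C, schwartz phi ->
      dist_dt (dist_of (fun z => (u z)%:C)) phi
      + dist_dx (dist_of (fun z => (u z ^+ m)%:C)) phi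
      - dist_dx T phi = 0.

Definition compactly_supported (f : R -> R) : Prop :=
  exists K : set R, compact K /\ {ae mu, forall x, ~ K x -> f x = 0}.

End definitions.

(* Main.v *)
(* For u(x, t) = f(x - c t) the equation reads, on the Fourier side,
     xi * (F[f^m - c f](xi) - |xi|^alpha F[f^n](xi)) = 0.
   Both transforms are entire because f has compact support, so the even (odd)
   part of the first one expands at 0 in the powers xi^(2j + p), with p = 0
   (p = 1), and that of |xi|^alpha F[f^n] in the powers |xi|^alpha xi^(2j + p).
   As 0 < alpha < 2 no exponent occurs twice, hence all coefficients of F[f^n],
   that is all moments of f^n, vanish, and f^n = 0 almost everywhere.

   The distributional equation is only tested against Gaussians of width eps on
   the Fourier side, composed with the shear x - c t and multiplied by a fixed
   Gaussian in t.  This turns it into an identity between two functions of eps,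
   whose asymptotic expansions as eps -> 0 are then compared. *)

(* The Riesz derivative [T] is prescribed only on functions of the form [fourier_x psi], while the
   equation evaluates it at [d_x phi]. Hence the test functions come in explicit pairs with
   [fourier_x psi = d_x phi]. Such a [psi] must vanish at [xi = 0], which excludes the plain
   Gaussian; the lowest remaining choices are [xi^2 gauss] for the even moments and [i xi gauss] for
   the odd ones. Both have real transforms, so the real part of the equation suffices and the work
   is with real integrals. The phase [e^(i c t xi)] in [psi] cancels the phase that the translation
   by [c t] puts on the transform of [u^n], so that [t] factors out.

   Analyticity is replaced by expansions whose remainder bound holds on the whole line: such bounds
   can be integrated against any function with finite moments. From vanishing moments to [f^n = 0]
   the path is elementary: exponentials of polynomials, then exponentials of those, approximate
   indicators of half-lines on bounded sets, and Lebesgue differentiation concludes. *)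
Require Import Defs.
From mathcomp Require Import measurable_realfun ess_sup_inf ring lra.
Set Implicit Arguments.
Unset Strict Implicit.
Unset Printing Implicit Defensive.
Import Order.TTheory GRing.Theory Num.Theory.
Import numFieldNormedType.Exports.
Local Open Scope classical_set_scope.
Local Open Scope ring_scope.

(** * Affine changes of variables in Lebesgue integrals *)

Section lebesgue_affine.
Context {R : realType}.
Local Notation mu := (@lebesgue_measure R).
Local Notation intg f := (mu.-integrable [set: R] (EFin \o f)).

Lemma integrable_scale (r : R) (h : R -> R) : intg h -> intg (fun x => r * h x).
Proof.
by move=> ih; apply: eq_integrable (integrableZl measurableT r ih) => // x _ /=; rewrite EFinM.
Qed.

Lemma integrable_add (h k : R -> R) : intg h -> intg k -> intg (fun x => h x + k x).
Proof.
by move=> ih ik; apply: eq_integrable (integrableD measurableT ih ik) => // x _ /=; rewrite EFinD.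
Qed.

Lemma integrable_sub (h k : R -> R) : intg h -> intg k -> intg (fun x => h x - k x).
Proof.
by move=> ih ik; apply: eq_integrable (integrableB measurableT ih ik) => // x _ /=; rewrite EFinB.
Qed.

Lemma measurable_affine (e b : R) : measurable_fun [set: R] (fun x : R => e * x + b).
Proof. by apply: measurable_funD => //; apply: measurable_funM. Qed.

Definition pushforward_affine (e b : R) : {measure set (measurableTypeR R) -> \bar R}.
Proof.
refine (mscale (NngNum (normr_ge0 e))
  (pushforward mu (fun x : measurableTypeR R => (e * x + b : measurableTypeR R)))).
exact: measurable_affine.
Defined.

(** Lebesgue measure is determined by its values on half-open intervals, so only these are checked;
    the factor [|e|] compensates the scaling of the preimage by [1 / |e|]. *)
Lemma lebesgue_measure_affine (e b : R) (A : set R) : e != 0 -> measurable A ->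
  mu A = pushforward_affine e b A.
Proof.
move=> e0 mA; apply: lebesgue_measure_unique => //.
move=> _ [[u v] _ <-] /=; rewrite /mscale /= /pushforward.
rewrite lebesgue_measure_itv /=.
have [e_gt0|e_lt0|] := ltgtP 0 e; last by move/eqP; rewrite eq_sym (negbTE e0).
  rewrite (_ : _ @^-1` _ = `](u - b) / e, (v - b) / e]%classic); last first.
    apply/seteqP; split=> x /=; rewrite !in_itv /= ltr_pdivrMr// ler_pdivlMr//;
      by rewrite ltrBlDr lerBrDr (mulrC x).
  rewrite lebesgue_measure_itv /= !lte_fin ltr_pM2r ?invr_gt0// ltrD2r.
  case: ifPn => _; last by rewrite mule0.
  rewrite -!EFinB -EFinM (gtr0_norm e_gt0); congr EFin.
  by field.
(* For [e < 0] the map reverses order: the endpoints are exchanged and the closed end becomes the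
   left one. *)
rewrite (_ : _ @^-1` _ = `[(v - b) / e, (u - b) / e[%classic); last first.
  apply/seteqP; split=> x /=; rewrite !in_itv /= ltr_ndivlMr// ler_ndivrMr//;
    by rewrite ltrBlDr lerBrDr (mulrC x) andbC.
rewrite lebesgue_measure_itv /= !lte_fin ltr_nM2r ?invr_lt0// ltrD2r.
case: ifPn => _; last by rewrite mule0.
rewrite -!EFinB -EFinM (ltr0_norm e_lt0); congr EFin.
by field.
Qed.

Lemma ge0_integral_affine (e b : R) (h : R -> \bar R) : e != 0 ->
  measurable_fun [set: R] h -> (forall x, 0 <= h x)%E ->
  (\int[mu]_x h x = `|e|%:E * \int[mu]_x h (e * x + b)%R)%E.
Proof.
move=> e0 mh h0.
rewrite (@eq_measure_integral _ _ _ _ (pushforward_affine e b)); last first.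
  by move=> A mA _; exact: lebesgue_measure_affine.
rewrite ge0_integral_mscale//= ge0_integral_pushforward//.
exact: measurable_affine.
Qed.

Lemma integrable_affine (e b : R) (h : R -> R) : e != 0 -> intg h ->
  intg (fun x => h (e * x + b)).
Proof.
move=> e0 /integrableP[mh ih]; apply/integrableP; split.
  apply/measurable_EFinP/measurableT_comp; last exact: measurable_affine.
  exact/measurable_EFinP.
move: ih; rewrite (@ge0_integral_affine e b (fun x => `|(h x)%:E|)%E)//; last first.
  exact: measurableT_comp.
(* An infinite integral would stay infinite after multiplication by [|e| > 0]. *)
rewrite !ltey; apply: contraNN => /eqP ->.
by rewrite gt0_muley // lte_fin normr_gt0.
Qed.

Lemma integral_affine (e b : R) (h : R -> R) : e != 0 -> intg h ->
  (\int[mu]_x (h x)%:E = `|e|%:E * \int[mu]_x (h (e * x + b)%R)%:E)%E.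
Proof.
move=> e0 ih.
have mh : measurable_fun [set: R] (EFin \o h) by move/integrableP : ih => [].
have iha := integrable_affine b e0 ih.
rewrite integralE [X in (_ * X)%E]integralE muleBr//; last first.
  exact: (integrable_add_def measurableT iha).
rewrite (@ge0_integral_affine e b (fun x => (EFin \o h)^\+%E x))//; last first.
  exact: measurable_funepos.
rewrite (@ge0_integral_affine e b (fun x => (EFin \o h)^\-%E x))//; last first.
  exact: measurable_funeneg.
congr (_ * _ - _ * _)%E; apply: eq_integral => x _.
  by rewrite !funeposE.
by rewrite !funenegE.
Qed.

Lemma Rintegral_affine (e b : R) (h : R -> R) : e != 0 -> intg h ->
  \int[mu]_x h x = `|e| * \int[mu]_x h (e * x + b).
Proof.
move=> e0 ih; rewrite /Rintegral (integral_affine b e0 ih) fineM//.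
apply: integrable_fin_num => //; exact: integrable_affine.
Qed.

Lemma Rintegral_shift (b : R) (h : R -> R) : intg h ->
  \int[mu]_x h (x + b) = \int[mu]_x h x.
Proof.
move=> ih; rewrite (@Rintegral_affine 1 b h)// normr1 mul1r.
by apply: eq_Rintegral => x _; rewrite mul1r.
Qed.

Lemma Rintegral_odd (h : R -> R) : intg h -> (forall x, h (- x) = - h x) ->
  \int[mu]_x h x = 0.
Proof.
move=> ih hN; suff : \int[mu]_x h x = - \int[mu]_x h x.
  by move/eqP; rewrite -addr_eq0 -mulr2n mulrn_eq0 => /eqP.
rewrite {1}(@Rintegral_affine (-1) 0 h)// ?oppr_eq0// normrN1 mul1r.
rewrite -[RHS]mulN1r -RintegralZl//; apply: eq_Rintegral => x _.
by rewrite addr0 mulN1r hN mulN1r.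
Qed.

Let measurable_shear_prod (c : R) (G th : R -> R) :
  measurable_fun [set: R] G -> measurable_fun [set: R] th ->
  measurable_fun [set: R * R] (fun z : R * R => G (z.1 - c * z.2) * th z.2).
Proof.
move=> mG mth; apply: measurable_funM.
  apply: (measurableT_comp mG); apply: measurable_funB => //.
  by apply: measurable_funM.
exact: measurableT_comp.
Qed.

(** Tonelli with [x] innermost: for fixed [t], the shift by [c t] does not change the integral of
    [|G|], so the shear disappears. The factorization of the integral below rests on the same
    remark. *)
Lemma integrable_shear_prod (c : R) (G th : R -> R) : intg G -> intg th ->
  (mu \x mu)%E.-integrable [set: R * R]
    (EFin \o (fun z : R * R => G (z.1 - c * z.2) * th z.2)).
Proof.
move=> iG ith.
have /measurable_EFinP mG := measurable_int _ iG.
have /measurable_EFinP mth := measurable_int _ ith.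
apply/integrable21ltyP.
  by apply/measurable_EFinP; exact: measurable_shear_prod.
rewrite (eq_integral (fun y : measurableTypeR R =>
    `|(th y)%:E| * \int[mu]_x `|(G x)%:E|)%E); last first.
  move=> y _.
  under eq_integral do rewrite /= normrM EFinM muleC.
  rewrite ge0_integralZl//=; last first.
    apply/measurable_EFinP; apply: measurableT_comp => //.
    by apply: measurableT_comp => //; exact: measurable_funB.
  congr (_ * _)%E.
  rewrite [RHS](@ge0_integral_affine 1 (- (c * y)) (fun x => `|G x|%:E)%E)//; last first.
    by apply/measurable_EFinP; exact: measurableT_comp.
  by rewrite normr1 mul1e; under [RHS]eq_integral do rewrite mul1r.
rewrite ge0_integralZr//; last 2 first.
  - exact/measurable_EFinP/measurableT_comp.
  - exact: integral_ge0.
move/integrableP : ith => [_ ith]; move/integrableP : iG => [_ iG].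
apply: lte_mul_pinfty => //; first exact: integral_ge0.
by rewrite ge0_fin_numE//; exact: integral_ge0.
Qed.

Lemma Rintegral_shear_prod (c : R) (G th : R -> R) : intg G -> intg th ->
  \int[(mu \x mu)%E]_z (G (z.1 - c * z.2) * th z.2) =
  (\int[mu]_x G x) * \int[mu]_t th t.
Proof.
move=> iG ith.
rewrite /Rintegral -[in LHS]integral21_prod_meas1/=; last exact: integrable_shear_prod.
rewrite (eq_integral (fun y : measurableTypeR R => (\int[mu]_x G x)%:E * (th y)%:E)%E); last first.
  move=> y _; rewrite /fubini_G /=.
  under eq_integral do rewrite EFinM.
  have iGy : intg (fun x => G (1 * x + - (c * y))) by exact: integrable_affine.
  rewrite integralZr//; last by under eq_fun do rewrite -[X in X - _]mul1r.
  congr (_ * _)%E; rewrite fineK; last exact: integrable_fin_num.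
  rewrite [RHS](@integral_affine 1 (- (c * y)))// normr1 mul1e.
  by under [RHS]eq_integral do rewrite mul1r.
rewrite integralZl// fineM//; exact: integrable_fin_num.
Qed.

End lebesgue_affine.

(** * The Gaussian and its Fourier transform *)

Section gauss.
Context {R : realType}.
Local Notation mu := (@lebesgue_measure R).
Local Notation intg f := (mu.-integrable [set: R] (EFin \o f)).

Lemma dominated_cvg_Rintegral (h_ : nat -> R -> R) (h g : R -> R) :
  (forall n, measurable_fun [set: R] (h_ n)) ->
  (forall x, h_ ^~ x @ \oo --> h x) ->
  intg g -> (forall n x, `|h_ n x| <= g x) ->
  (fun n => \int[mu]_x h_ n x) @ \oo --> \int[mu]_x h x.
Proof.
move=> mh_ h_h ig h_g.
have mh : measurable_fun [set: R] h.
  by apply: (@measurable_fun_cvg _ _ _ setT h_) => // x _; exact: h_h.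
have [|||||ih _ cvgh] := @dominated_convergence _ _ R mu setT measurableT
    (fun n => EFin \o h_ n) (EFin \o h) (EFin \o g).
- by move=> n; apply/measurable_EFinP; exact: mh_.
- by apply/measurable_EFinP; exact: mh.
- by apply: aeW => /= x _; apply/fine_cvgP; split; [exact: nearW|exact: h_h].
- by [].
- by apply: aeW => /= x n _; rewrite lee_fin.
move: cvgh; rewrite -[X in _ --> X]fineK; last exact: integrable_fin_num.
by move=> /fine_cvgP[].
Qed.

Lemma expr_le_fact_expR (N : nat) (y : R) : 0 <= y -> y ^+ N <= N`!%:R * expR y.
Proof.
move=> y0; case: N => [|N].
  by rewrite expr0 fact0 mul1r (le_trans _ (expR_ge1Dx _))// lerDl.
rewrite mulrC -ler_pdivrMr ?ltr0n ?fact_gt0//.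
by rewrite (le_trans _ (expR_ge1Dxn N y0))// lerDr.
Qed.

Lemma ler_norm_1Dsqr (x : R) : `|x| <= 1 + x ^+ 2.
Proof.
rewrite -[x ^+ 2]ger0_norm ?sqr_ge0// normrX.
by rewrite -subr_ge0 (_ : _ - _ = (`|x| - 1/2) ^+ 2 + 3 / 4); [rewrite addr_ge0 ?sqr_ge0|field].
Qed.

(** Scaled so that its Fourier transform is a multiple of [gauss] itself. *)
Definition gauss (x : R) : R := expR (- (x ^+ 2 / 2)).

Lemma gauss_gt0 x : 0 < gauss x. Proof. exact: expR_gt0. Qed.

Lemma gauss_ge0 x : 0 <= gauss x. Proof. exact: expR_ge0. Qed.

Lemma gaussN x : gauss (- x) = gauss x. Proof. by rewrite /gauss sqrrN. Qed.

Lemma measurable_gauss : measurable_fun [set: R] gauss.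
Proof.
apply: measurableT_comp => //; apply: measurableT_comp => //.
by apply: measurable_funM => //; exact: measurable_funX.
Qed.

(** The factorial bound at [(1 + x^2) / 4] costs [e^(x^2 / 4)], half of the decay of [gauss]. The
    other half is [gauss_fun (x / 2)], which is integrable and at most [1]. *)
Lemma poly_growth_gauss (N : nat) (x : R) :
  (1 + x ^+ 2) ^+ N * gauss x <=
  4 ^+ N * N`!%:R * expR (1 / 4) * gauss_fun (1 / 2 * x).
Proof.
have x2 := sqr_ge0 x.
have := @expr_le_fact_expR N ((1 + x ^+ 2) / 4) (ltac:(lra)).
rewrite expr_div_n ler_pdivrMr ?exprn_gt0// => /(ler_wpM2r (gauss_ge0 x)).
move=> /le_trans; apply.
rewrite le_eqVlt; apply/orP; left; apply/eqP.
rewrite /gauss /gauss_fun.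
have -> : expR (- (1 / 2 * x) ^+ 2) =
    expR (x ^+ 2 / 4) * expR (- (x ^+ 2 / 2)) :> R.
  by rewrite -expRD; congr expR; field.
have -> : expR ((1 + x ^+ 2) / 4) = expR (1 / 4) * expR (x ^+ 2 / 4) :> R.
  by rewrite -expRD; congr expR; field.
by ring.
Qed.

Lemma integrable_mul_gauss (h : R -> R) (K : R) (N : nat) :
  measurable_fun [set: R] h -> (forall x, `|h x| <= K * (1 + x ^+ 2) ^+ N) ->
  intg (fun x => h x * gauss x).
Proof.
move=> mh hK.
have K0 : 0 <= K by have := hK 0; rewrite expr0n addr0 expr1n mulr1; exact: le_trans.
have mg := measurable_gauss.
have ig : intg (fun x => (K * (4 ^+ N * N`!%:R * expR (1 / 4))) * gauss_fun (1 / 2 * x)).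
  rewrite (_ : _ \o _ = fun x => ((K * (4 ^+ N * N`!%:R * expR (1 / 4)))%:E *
      (EFin \o (fun x => gauss_fun (1 / 2 * x + 0))) x)%E); last first.
    by apply/funext => x /=; rewrite addr0 EFinM.
  apply: integrableZl => //; apply: integrable_affine => //.
  exact: integrableT_gauss.
apply: (le_integrable measurableT _ _ ig).
  by apply/measurable_EFinP; exact: measurable_funM.
move=> x _ /=; rewrite lee_fin normrM (ger0_norm (gauss_ge0 x)).
rewrite (le_trans _ (ler_norm _))// -mulrA.
apply: le_trans (ler_wpM2l K0 (poly_growth_gauss N x)).
by rewrite mulrA ler_wpM2r// gauss_ge0.
Qed.

Lemma integrable_gauss : intg gauss.
Proof.
have := @integrable_mul_gauss (cst 1) 1 0 (measurable_cst _).
rewrite (_ : (fun _ => _) = gauss); last by apply/funext => x; rewrite mul1r.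
by apply => x /=; rewrite normr1 expr0 mulr1.
Qed.

Lemma continuous_gauss : continuous gauss.
Proof.
move=> x; apply: continuous_comp; last exact: continuous_expR.
apply: continuousN; apply: continuousM; last exact: cst_continuous.
exact: exprn_continuous.
Qed.

Definition gauss_mass : R := \int[mu]_x gauss x.

(** Positivity is not asked at [0], where the weights [|x|^alpha x^i] vanish. A zero integral would
    make [h] vanish almost everywhere, although it is positive on []0, 1]], a set of measure [1]. *)
Lemma Rintegral_gt0 (h : R -> R) : intg h -> (forall x, 0 <= h x) ->
  (forall x, x != 0 -> 0 < h x) -> 0 < \int[mu]_x h x.
Proof.
move=> ih h0 hpos; rewrite lt_neqAle Rintegral_ge0 ?andbT//.
apply/negP => /eqP ih0.
have : ae_eq mu setT (EFin \o h) (cst 0%E).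
  apply/ae_eq_integral_abs => //; first exact: measurable_int ih.
  under eq_integral do rewrite /= ger0_norm//.
  rewrite -[LHS]fineK; last exact: integrable_fin_num.
  by congr EFin; rewrite ih0.
move=> [N [mN N0 subN]].
have : (mu `]0%R, 1%R] <= mu N)%E.
  apply: le_measure; rewrite ?inE// => x /=; rewrite in_itv /= => /andP[x0 _].
  apply: subN => /= /(_ I)[] /eqP; rewrite gt_eqF// hpos//.
  by rewrite gt_eqF.
by rewrite N0 lebesgue_measure_itv /= lte_fin ltr01 oppr0 adde0 lee_fin ler10.
Qed.

(** The source of every integration by parts below. Limits along the integers suffice, since the
    integrals over [[- n, n]] already converge to the full one. *)
Lemma Rintegral_derive0 (G g : R -> R) :
  (forall x, is_derive x (1 : R) G (g x)) -> continuous g -> intg g ->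
  (fun n : nat => G n%:R) @ \oo --> (0 : R) ->
  (fun n : nat => G (- n%:R)) @ \oo --> (0 : R) ->
  \int[mu]_x g x = 0.
Proof.
move=> dG cg ig Gy GNy.
(* With [n.+1] the interval is nondegenerate even at [n = 0]; the fundamental theorem is applied
   with distinct endpoints. *)
pose h_ (n : nat) : R -> R := g \_ `[- n.+1%:R, n.+1%:R]%classic.
have mg : measurable_fun [set: R] g by exact: continuous_measurable_fun.
have : (fun n => \int[mu]_x h_ n x) @ \oo --> \int[mu]_x g x.
  apply: (@dominated_cvg_Rintegral _ _ (fun x => `|g x|)).
  - move=> n; apply/(measurable_restrictT _ (measurable_itv _)).
    exact: measurable_funTS.
  - move=> x; apply/cvgrPdist_lt => e e0.
    exists (Num.truncn `|x|) => //= n /= xn.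
    rewrite /h_ patchE mem_set/= ?subrr ?normr0// in_itv /= -ler_norml.
    have /andP[_ /ltW] := Num.Theory.truncn_itv (normr_ge0 x).
    by move=> /le_trans; apply; rewrite ler_nat.
  - exact: integrable_norm.
  - move=> n x; rewrite /h_ patchE; case: ifPn => // _.
    by rewrite normr0.
have intE n : \int[mu]_x h_ n x = G n.+1%:R - G (- n.+1%:R).
  rewrite /h_ -Rintegral_mkcond /Rintegral.
  rewrite (@continuous_FTC2 _ g G)//.
  - by rewrite (lt_le_trans (_ : _ < 0)) ?oppr_lt0 ?ltr0n.
  - exact: continuous_subspaceT.
  - have cG x : G y @[y --> x] --> G x.
      by apply: differentiable_continuous; apply/derivable1_diffP; case: (dG x).
    split => [x _| | ]; first by case: (dG x).
    + exact: cvg_at_right_filter.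
    + exact: cvg_at_left_filter.
  - by move=> x _; rewrite derive1E; case: (dG x).
under eq_fun do rewrite intE.
have : (fun n => G n.+1%:R - G (- n.+1%:R)) @ \oo --> (0 - 0 : R).
  apply: cvgB.
    by rewrite (cvg_shiftS (fun n : nat => G n%:R)).
  by rewrite (cvg_shiftS (fun n : nat => G (- n%:R))).
by rewrite subr0 => h1 h2; exact: (cvg_unique _ h2 h1).
Qed.

Lemma is_derive_gauss x : is_derive x (1 : R) gauss (- x * gauss x).
Proof.
rewrite /gauss; apply: is_derive_eq.
by rewrite /GRing.scale /=; field.
Qed.

Lemma is_derive_cosM (a x : R) : is_derive x (1 : R) (fun y => cos (a * y)) (- a * sin (a * x)).
Proof. by apply: is_derive_eq; rewrite /GRing.scale /=; ring. Qed.

Lemma is_derive_sinM (a x : R) : is_derive x (1 : R) (fun y => sin (a * y)) (a * cos (a * x)).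
Proof. by apply: is_derive_eq; rewrite /GRing.scale /=; ring. Qed.

(** The condition on [u] covers the sequences [n] and [- n] at once. Absorbing one power of
    [1 + x^2] more than [h] requires leaves a decay of at least [1 / (n + 1)]. *)
Lemma cvg_mul_gauss (h : R -> R) (K : R) (N : nat) (u : nat -> R) :
  (forall x, `|h x| <= K * (1 + x ^+ 2) ^+ N) -> (forall n, u n ^+ 2 = n%:R ^+ 2) ->
  (fun n => h (u n) * gauss (u n)) @ \oo --> (0 : R).
Proof.
move=> hK u2.
have K0 : 0 <= K by have := hK 0; rewrite expr0n addr0 expr1n mulr1; exact: le_trans.
pose C := K * (4 ^+ N.+1 * (N.+1)`!%:R * expR (1 / 4)).
have hC n : `|h (u n) * gauss (u n)| <= C * harmonic n.
  rewrite /harmonic /= ler_pdivlMr// normrM (ger0_norm (gauss_ge0 _)).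
  have := ler_wpM2l K0 (poly_growth_gauss N.+1 (u n)).
  set B := (_ * gauss_fun _); move=> le1.
  have le2 : K * B <= C.
    rewrite /B /C ler_wpM2l// ler_piMr ?gauss_fun_le1//.
  apply: le_trans le2; apply: le_trans le1.
  have -> : K * ((1 + u n ^+ 2) ^+ N.+1 * gauss (u n)) =
      K * (1 + u n ^+ 2) ^+ N * gauss (u n) * (1 + u n ^+ 2) by rewrite exprSr; ring.
  apply: ler_pM => //; first by rewrite mulr_ge0// gauss_ge0.
    by rewrite ler_wpM2r// gauss_ge0.
  rewrite u2 -natrX -natr1 addrC lerD2l ler_nat.
  by case: (n) => // k; rewrite leq_pmulr.
apply/cvgr0Pnorm_le => e e0.
have : (fun n => C * harmonic n) @ \oo --> (C * 0 : R).
  by apply: cvgM; [exact: cvg_cst|exact: cvg_harmonic].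
rewrite mulr0 => /cvgr0Pnorm_le /(_ e e0); apply: filterS => n.
by move=> /(le_trans _); apply; rewrite (le_trans (hC n))// ler_norm.
Qed.

Let trig_growth (t : R -> R) (i : nat) (a : R) : (forall x, `|t x| <= 1) -> (i <= 2)%N ->
  forall x, `|x ^+ i * t (a * x)| <= 1 * (1 + x ^+ 2) ^+ 1.
Proof.
move=> t1 i2 x; rewrite mul1r expr1 normrM -[leRHS]mulr1; apply: ler_pM => //.
rewrite normrX; case: i i2 => [|[|[|]]]// _; rewrite ?expr0 ?expr1.
- by rewrite lerDl sqr_ge0.
- exact: ler_norm_1Dsqr.
- by rewrite real_normK ?num_real// lerDr.
Qed.

Let measurable_trig (t : R -> R) (i : nat) (a : R) : continuous t ->
  measurable_fun [set: R] (fun x => x ^+ i * t (a * x)).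
Proof.
move=> ct; apply: measurable_funM; first exact: measurable_funX.
apply: measurableT_comp; first exact: continuous_measurable_fun.
exact: measurable_funM.
Qed.

Lemma integrable_trig_gauss (t : R -> R) (i : nat) (a : R) : continuous t ->
  (forall x, `|t x| <= 1) -> (i <= 2)%N -> intg (fun x => x ^+ i * t (a * x) * gauss x).
Proof.
move=> ct t1 i2.
apply: (@integrable_mul_gauss (fun x => x ^+ i * t (a * x)) 1 1).
  exact: measurable_trig.
exact: trig_growth.
Qed.

Let continuous_trig_gauss (t : R -> R) (i : nat) (a : R) : continuous t ->
  continuous (fun x : R => x ^+ i * t (a * x) * gauss x).
Proof.
move=> ct x; apply: cvgM; last exact: continuous_gauss.
apply: cvgM; first exact: exprn_continuous.
by apply: continuous_comp; [exact: mulrl_continuous|exact: ct].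
Qed.

(** Integration by parts: the derivative of [sin (a x) gauss x] has integral zero. The powers
    [x ^+ 0] and [x ^+ 1] stay unsimplified so that one integrability lemma serves all these
    integrals. *)
Lemma fourier_gauss_sin1 (a : R) :
  \int[mu]_x (x ^+ 1 * sin (a * x) * gauss x) =
  a * \int[mu]_x (x ^+ 0 * cos (a * x) * gauss x).
Proof.
have ic := @integrable_trig_gauss cos 0 a (@continuous_cos R) (@cos_max R) isT.
have is1 := @integrable_trig_gauss sin 1 a (@continuous_sin R) (@sin_max R) isT.
have iac : intg (fun x => a * (x ^+ 0 * cos (a * x) * gauss x)).
  exact: (integrable_scale _ ic).
have cg : continuous (fun x : R => a * (x ^+ 0 * cos (a * x) * gauss x) -
    x ^+ 1 * sin (a * x) * gauss x).
  move=> x; apply: cvgB; last exact/continuous_trig_gauss/continuous_sin.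
  by apply: cvgM; [exact: cvg_cst|exact/continuous_trig_gauss/continuous_cos].
have : \int[mu]_x (a * (x ^+ 0 * cos (a * x) * gauss x) - x ^+ 1 * sin (a * x) * gauss x) = 0.
  apply: (@Rintegral_derive0 (fun x => sin (a * x) * gauss x)).
  - move=> x; have ? := is_derive_gauss x; have ? := is_derive_sinM a x.
    by apply: is_derive_eq; rewrite /GRing.scale /=; ring.
  - exact: cg.
  - exact: (integrable_sub iac is1).
  - apply: (@cvg_mul_gauss (fun x => sin (a * x)) 1 0) => // x.
    by rewrite expr0 mulr1 sin_max.
  - apply: (@cvg_mul_gauss (fun x => sin (a * x)) 1 0) => [x|n]; last by rewrite sqrrN.
    by rewrite expr0 mulr1 sin_max.
rewrite RintegralB// RintegralZl// => /eqP; rewrite subr_eq0 => /eqP ->.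
by [].
Qed.

(** The same integration by parts, applied to [x cos (a x) gauss x]. *)
Lemma fourier_gauss_cos2 (a : R) :
  \int[mu]_x (x ^+ 2 * cos (a * x) * gauss x) =
  \int[mu]_x (x ^+ 0 * cos (a * x) * gauss x) - a * \int[mu]_x (x ^+ 1 * sin (a * x) * gauss x).
Proof.
have ic := @integrable_trig_gauss cos 0 a (@continuous_cos R) (@cos_max R) isT.
have ic2 := @integrable_trig_gauss cos 2 a (@continuous_cos R) (@cos_max R) isT.
have is1 := @integrable_trig_gauss sin 1 a (@continuous_sin R) (@sin_max R) isT.
have ias : intg (fun x => a * (x ^+ 1 * sin (a * x) * gauss x)).
  exact: (integrable_scale _ is1).
have icas : intg (fun x => x ^+ 0 * cos (a * x) * gauss x - a * (x ^+ 1 * sin (a * x) * gauss x)).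
  exact: (integrable_sub ic ias).
have cg : continuous (fun x : R => x ^+ 0 * cos (a * x) * gauss x -
    a * (x ^+ 1 * sin (a * x) * gauss x) - x ^+ 2 * cos (a * x) * gauss x).
  move=> x; apply: cvgB; last exact/continuous_trig_gauss/continuous_cos.
  apply: cvgB; first exact/continuous_trig_gauss/continuous_cos.
  by apply: cvgM; [exact: cvg_cst|exact/continuous_trig_gauss/continuous_sin].
have : \int[mu]_x (x ^+ 0 * cos (a * x) * gauss x - a * (x ^+ 1 * sin (a * x) * gauss x)
    - x ^+ 2 * cos (a * x) * gauss x) = 0.
  apply: (@Rintegral_derive0 (fun x => x * cos (a * x) * gauss x)).
  - move=> x; have ? := is_derive_gauss x; have ? := is_derive_cosM a x.
    by apply: is_derive_eq; rewrite /GRing.scale /=; ring.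
  - exact: cg.
  - exact: (integrable_sub icas ic2).
  - apply: (@cvg_mul_gauss (fun x => x * cos (a * x)) 1 1) => // x.
    by rewrite -[X in X * _]expr1; apply: trig_growth => //; exact: cos_max.
  - apply: (@cvg_mul_gauss (fun x => x * cos (a * x)) 1 1) => [x|n]; last by rewrite sqrrN.
    by rewrite -[X in X * _]expr1; apply: trig_growth => //; exact: cos_max.
rewrite RintegralB// RintegralB// RintegralZl// => /eqP; rewrite subr_eq0 => /eqP ->.
by [].
Qed.

Lemma is_derive_fourier_gauss (a : R) :
  is_derive a (1 : R) (fun a => \int[mu]_x (x ^+ 0 * cos (a * x) * gauss x))
    (- \int[mu]_x (x ^+ 1 * sin (a * x) * gauss x)).
Proof.
pose f (b x : R) : R := x ^+ 0 * cos (b * x) * gauss x.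
have df b x : is_derive b (1 : R) (f^~ x) (- (x ^+ 1 * sin (b * x) * gauss x)).
  by rewrite /f; apply: is_derive_eq; rewrite /GRing.scale /=; ring.
have d1f b x : partial1of2 f b x = - (x ^+ 1 * sin (b * x) * gauss x).
  by rewrite partial1of2E; case: (df b x).
have inf b : intg (f b) by exact: (@integrable_trig_gauss cos 0 b (@continuous_cos R) (@cos_max R)).
(* This dominates the derivative in the parameter uniformly, so the window []a - 1, a + 1[] is
   arbitrary. *)
pose G (x : R) : R := `|x| * gauss x.
have G0 x : 0 <= G x by rewrite mulr_ge0// gauss_ge0.
have iG : intg G.
  apply: (@integrable_mul_gauss (fun x => `|x|) 1 1) => // x.
  have := @trig_growth (cst 1) 1 0 _ isT x; rewrite /= mulr1 normr_id expr1.
  by apply=> y; rewrite normr1.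
have Ia : `]a - 1, a + 1[%classic a by rewrite /= in_itv /= ltrBlDr ltrDl ltr01.
have fG b x : `]a - 1, a + 1[%classic b -> [set: R] x -> `|partial1of2 f b x| <= G x.
  move=> _ _; rewrite d1f normrN !normrM expr1 (ger0_norm (gauss_ge0 x)) /G.
  by rewrite ler_wpM2r ?gauss_ge0// ler_piMr// sin_max.
have df1 b x : `]a - 1, a + 1[%classic b -> [set: R] x -> derivable (f^~ x) b 1.
  by move=> _ _; case: (df b x).
apply: DeriveDef.
  exact: (@derivable_under_integral R _ _ mu f setT measurableT a (a - 1) (a + 1) Ia
    (fun b _ => inf b) df1 G G0 iG fG).
rewrite -derive1E (@differentiation_under_integral R _ _ mu f setT measurableT a (a - 1) (a + 1) Ia
    (fun b _ => inf b) df1 G G0 iG fG).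
under eq_Rintegral do rewrite d1f -mulN1r.
rewrite RintegralZl// ?mulN1r//.
exact: (@integrable_trig_gauss sin 1 a (@continuous_sin R) (@sin_max R)).
Qed.

(** The transform [y] solves [y' = - a y], by differentiation under the integral followed by
    integration by parts. Hence [y(a) e^(a^2 / 2)] is constant, equal to its value [gauss_mass] at
    [0]. *)
Lemma fourier_gauss_cos0 (a : R) :
  \int[mu]_x (x ^+ 0 * cos (a * x) * gauss x) = gauss_mass * gauss a.
Proof.
set y : R -> R := fun a => \int[mu]_x (x ^+ 0 * cos (a * x) * gauss x).
have dy b : is_derive b (1 : R) y (- (b * y b)).
  have := is_derive_fourier_gauss b; rewrite fourier_gauss_sin1.
  exact.
have ec b : is_derive b (1 : R) (fun b => expR (b ^+ 2 / 2)) (b * expR (b ^+ 2 / 2)).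
  by apply: is_derive_eq; rewrite /GRing.scale /=; field.
have : forall b, is_derive b (1 : R) (y * (fun b => expR (b ^+ 2 / 2))) 0.
  move=> b; have ? := dy b; have ? := ec b.
  by apply: is_derive_eq; rewrite /GRing.scale /=; ring.
move=> /(is_derive_0_is_cst a 0) cst_y.
have : y a * expR (a ^+ 2 / 2) = y 0 * expR (0 ^+ 2 / 2) by exact: cst_y.
rewrite expr0n mul0r expR0 mulr1.
have -> : y 0 = gauss_mass.
  by apply: eq_Rintegral => x _; rewrite mul0r cos0 expr0 !mul1r.
move=> <-; rewrite /gauss -mulrA -expRD subrr expR0 mulr1.
by [].
Qed.

Lemma gauss_fourier_sin (a : R) :
  \int[mu]_x (x ^+ 1 * sin (a * x) * gauss x) = gauss_mass * (a * gauss a).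
Proof. by rewrite fourier_gauss_sin1 fourier_gauss_cos0; ring. Qed.

Lemma gauss_fourier_cos (a : R) :
  \int[mu]_x (x ^+ 2 * cos (a * x) * gauss x) = gauss_mass * ((1 - a ^+ 2) * gauss a).
Proof.
by rewrite fourier_gauss_cos2 fourier_gauss_sin1 fourier_gauss_cos0; ring.
Qed.

Lemma gauss_mass_gt0 : 0 < gauss_mass.
Proof.
apply: Rintegral_gt0; first exact: integrable_gauss.
  by move=> x; exact: gauss_ge0.
by move=> x _; exact: gauss_gt0.
Qed.

End gauss.

(** * Schwartz functions *)

Section schwartz_gaussian.
Local Open Scope complex_scope.
Context {R : realType}.
Local Notation plane := (R * R)%type.
Implicit Types (p q Q : plane -> R) (v z : plane).

(* Closed under partial derivatives and of polynomial growth, so that its products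
   with [expR (- Q)] are Schwartz functions for a coercive quadratic [Q]. *)
Inductive trig_poly : (plane -> R) -> Prop :=
| trig_poly_cst c : trig_poly (fun=> c)
| trig_poly_fst : trig_poly fst
| trig_poly_snd : trig_poly snd
| trig_polyD p q : trig_poly p -> trig_poly q -> trig_poly (fun z => p z + q z)
| trig_polyM p q : trig_poly p -> trig_poly q -> trig_poly (fun z => p z * q z)
| trig_poly_cos p : trig_poly p -> trig_poly (fun z => cos (p z))
| trig_poly_sin p : trig_poly p -> trig_poly (fun z => sin (p z)).

Lemma trig_polyB p q : trig_poly p -> trig_poly q -> trig_poly (fun z => p z - q z).
Proof.
move=> tp tq; rewrite (_ : (fun z => _) = (fun z => p z + (-1) * q z)).
  by apply: trig_polyD => //; apply: trig_polyM => //; exact: trig_poly_cst.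
by apply/funext => z; rewrite mulN1r.
Qed.

Lemma is_derive_comp1 (h h' : R -> R) p v z : (forall y, is_derive y (1 : R) h (h' y)) ->
  differentiable p z -> differentiable (fun z => h (p z)) z /\
  'D_v (fun z => h (p z)) z = h' (p z) * 'D_v p z.
Proof.
move=> dh dp.
have dhp : differentiable h (p z) by apply/derivable1_diffP; case: (dh (p z)).
have dc : differentiable (h \o p) z by exact: differentiable_comp.
split; first exact: dc.
rewrite (@deriveE _ _ _ (h \o p))// deriveE// diff_comp//= diff1E//=.
by rewrite derive1E (@derive_val _ _ _ _ _ _ _ (dh (p z))) mulrC.
Qed.

Lemma differentiable_fst z : differentiable (@fst R R) z.
Proof. by apply: linear_differentiable => ?; exact: cvg_fst. Qed.

Lemma differentiable_snd z : differentiable (@snd R R) z.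
Proof. by apply: linear_differentiable => ?; exact: cvg_snd. Qed.

Lemma derive_fst v z : 'D_v (@fst R R) z = v.1.
Proof.
rewrite deriveE; last exact: differentiable_fst.
by rewrite diff_lin// => ?; exact: cvg_fst.
Qed.

Lemma derive_snd v z : 'D_v (@snd R R) z = v.2.
Proof.
rewrite deriveE; last exact: differentiable_snd.
by rewrite diff_lin// => ?; exact: cvg_snd.
Qed.

Lemma trig_poly_differentiable p z : trig_poly p -> differentiable p z.
Proof.
elim=> [c| | |{}p q _ dp _ dq|{}p q _ dp _ dq|{}p _ dp|{}p _ dp].
- exact: differentiable_cst.
- exact: differentiable_fst.
- exact: differentiable_snd.
- exact: differentiableD.
- exact: differentiableM.
- exact: (is_derive_comp1 0 (@is_derive_cos R) dp).1.
- exact: (is_derive_comp1 0 (@is_derive_sin R) dp).1.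
Qed.

Lemma trig_poly_derive p v : trig_poly p -> trig_poly (fun z => 'D_v p z).
Proof.
elim=> [c| | |{}p q tp dp tq dq|{}p q tp dp tq dq|{}p tp dp|{}p tp dp].
- rewrite (_ : 'D_v _ = fun=> 0); first exact: trig_poly_cst.
  by apply/funext => z; rewrite derive_cst.
- rewrite (_ : 'D_v _ = fun=> v.1); first exact: trig_poly_cst.
  by apply/funext => z; rewrite derive_fst.
- rewrite (_ : 'D_v _ = fun=> v.2); first exact: trig_poly_cst.
  by apply/funext => z; rewrite derive_snd.
- rewrite (_ : 'D_v _ = fun z => 'D_v p z + 'D_v q z); first exact: trig_polyD.
  by apply/funext => z; rewrite deriveD//; apply: diff_derivable; exact: trig_poly_differentiable.
- rewrite (_ : 'D_v _ = fun z => p z * 'D_v q z + q z * 'D_v p z).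
    by apply: trig_polyD; exact: trig_polyM.
  by apply/funext => z; rewrite deriveM//; apply: diff_derivable; exact: trig_poly_differentiable.
- rewrite (_ : 'D_v _ = fun z => (-1) * (sin (p z)) * 'D_v p z).
    do 2 (apply: trig_polyM => //); first exact: trig_poly_cst.
    exact: trig_poly_sin.
  apply/funext => z; rewrite mulN1r.
  by rewrite (is_derive_comp1 _ (@is_derive_cos R) (trig_poly_differentiable z tp)).2.
- rewrite (_ : 'D_v _ = fun z => cos (p z) * 'D_v p z).
    by apply: trig_polyM => //; exact: trig_poly_cos.
  apply/funext => z.
  by rewrite (is_derive_comp1 _ (@is_derive_sin R) (trig_poly_differentiable z tp)).2.
Qed.

Lemma trig_poly_growth p : trig_poly p ->
  exists (K : R) (N : nat), forall z, `|p z| <= K * (1 + (z.1 ^+ 2 + z.2 ^+ 2)) ^+ N.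
Proof.
have ge1 z : 1 <= 1 + (z.1 ^+ 2 + z.2 ^+ 2) by rewrite lerDl addr_ge0 ?sqr_ge0.
elim=> [c| | |{}p q _ [K1 [N1 h1]] _ [K2 [N2 h2]]
       |{}p q _ [K1 [N1 h1]] _ [K2 [N2 h2]]|{}p _ _|{}p _ _].
- by exists `|c|, 0%N => z; rewrite expr0 mulr1.
- by exists 1, 1%N => z; rewrite mul1r expr1 (le_trans (ler_norm_1Dsqr _))// lerD2l lerDl sqr_ge0.
- by exists 1, 1%N => z; rewrite mul1r expr1 (le_trans (ler_norm_1Dsqr _))// lerD2l lerDr sqr_ge0.
- exists (`|K1| + `|K2|), (N1 + N2)%N => z; rewrite mulrDl.
  have g0 : 0 <= 1 + (z.1 ^+ 2 + z.2 ^+ 2) := le_trans ler01 (ge1 z).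
  apply: le_trans (ler_normD _ _) (lerD _ _).
    apply: le_trans (h1 z) _.
    apply: (@le_trans _ _ (`|K1| * (1 + (z.1 ^+ 2 + z.2 ^+ 2)) ^+ N1)).
      by rewrite ler_wpM2r ?exprn_ge0// ler_norm.
    by rewrite ler_wpM2l// ler_weXn2l// leq_addr.
  apply: le_trans (h2 z) _.
  apply: (@le_trans _ _ (`|K2| * (1 + (z.1 ^+ 2 + z.2 ^+ 2)) ^+ N2)).
    by rewrite ler_wpM2r ?exprn_ge0// ler_norm.
  by rewrite ler_wpM2l// ler_weXn2l// leq_addl.
- exists (K1 * K2), (N1 + N2)%N => z; rewrite normrM exprD mulrACA.
  by apply: ler_pM.
- by exists 1, 0%N => z; rewrite expr0 mulr1 cos_max.
- by exists 1, 0%N => z; rewrite expr0 mulr1 sin_max.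
Qed.

Definition trig_gauss Q p q z : R[i] :=
  (p z * expR (- Q z)) +i* (q z * expR (- Q z)).

Lemma differentiable_mul_expR Q p z : trig_poly Q -> trig_poly p ->
  differentiable (fun z => p z * expR (- Q z)) z.
Proof.
move=> tQ tp; apply: differentiableM; first exact: trig_poly_differentiable.
have dQ : differentiable (fun z => - Q z) z.
  by apply: differentiableN; exact: trig_poly_differentiable.
exact: (is_derive_comp1 0 (@is_derive_expR R) dQ).1.
Qed.

Lemma derive_mul_expR Q p v z : trig_poly Q -> trig_poly p ->
  'D_v (fun z => p z * expR (- Q z)) z = ('D_v p z - p z * 'D_v Q z) * expR (- Q z).
Proof.
move=> tQ tp.
have dQ : differentiable (fun z => - Q z) z.
  by apply: differentiableN; exact: trig_poly_differentiable.
have [de De] := is_derive_comp1 v (@is_derive_expR R) dQ.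
have dp := trig_poly_differentiable z tp.
rewrite (@deriveM _ _ p (fun z => expR (- Q z)))//; [|exact: diff_derivable|exact: diff_derivable].
rewrite De deriveN; last by apply: diff_derivable; exact: trig_poly_differentiable.
by rewrite /GRing.scale /=; ring.
Qed.

Lemma partial_trig_gauss Q p q v : trig_poly Q -> trig_poly p -> trig_poly q ->
  partial v (trig_gauss Q p q) =
  trig_gauss Q (fun z => 'D_v p z - p z * 'D_v Q z) (fun z => 'D_v q z - q z * 'D_v Q z).
Proof.
move=> tQ tp tq; apply/funext => z; rewrite /partial /trig_gauss.
by congr (_ +i* _); exact: derive_mul_expR.
Qed.

(** The exponent [Q] does not change, so this iterates: smoothness and all seminorms reduce to
    bounding a single [trig_gauss Q p q] with arbitrary amplitudes. *)
Lemma partial_trig_gauss_ex Q p q v : trig_poly Q -> trig_poly p -> trig_poly q ->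
  exists p' q', [/\ trig_poly p', trig_poly q' &
    partial v (trig_gauss Q p q) = trig_gauss Q p' q'].
Proof.
move=> tQ tp tq; rewrite partial_trig_gauss//; do 2 eexists; split; last by [].
  by apply: trig_polyB; [exact: trig_poly_derive|apply: trig_polyM => //; exact: trig_poly_derive].
by apply: trig_polyB; [exact: trig_poly_derive|apply: trig_polyM => //; exact: trig_poly_derive].
Qed.

Lemma smooth_trig_gauss Q p q : trig_poly Q -> trig_poly p -> trig_poly q ->
  smooth (trig_gauss Q p q).
Proof.
move=> tQ tp tq w z /=.
have [p' [q' [tp' tq' ->]]] : exists p' q', [/\ trig_poly p', trig_poly q' &
    foldr (fun b : bool => if b then d_x else d_t) (trig_gauss Q p q) w = trig_gauss Q p' q'].
  elim: w => [|b w [p' [q' [tp' tq' IH]]]] /=; first by exists p, q.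
  by rewrite IH; case: b; exact: partial_trig_gauss_ex.
by split; exact: differentiable_mul_expR.
Qed.

Lemma normc_le (a b : R) : Normc.normc (a +i* b) <= `|a| + `|b|.
Proof.
rewrite /Normc.normc -[leRHS]ger0_norm ?addr_ge0// -sqrtr_sqr ler_sqrt ?sqr_ge0//.
rewrite sqrrD !real_normK ?num_real// -addrA lerD2l lerDr.
by rewrite mulrn_wge0// mulr_ge0.
Qed.

Lemma schwartz_trig_gauss Q p q (d : R) : trig_poly Q -> trig_poly p -> trig_poly q ->
  0 < d -> (forall z, d * (z.1 ^+ 2 + z.2 ^+ 2) <= Q z) ->
  schwartz (trig_gauss Q p q).
Proof.
move=> tQ tp tq d0 dQ; split; first exact: smooth_trig_gauss.
move=> i j a b.
have [p' [q' [tp' tq' eqt]]] : exists p' q', [/\ trig_poly p', trig_poly q' &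
    iter b d_t (trig_gauss Q p q) = trig_gauss Q p' q'].
  elim: b => [|b [p' [q' [tp' tq' IH]]]] /=; first by exists p, q.
  by rewrite IH; exact: partial_trig_gauss_ex.
have [p2 [q2 [tp2 tq2 eqx]]] : exists p2 q2, [/\ trig_poly p2, trig_poly q2 &
    iter a d_x (trig_gauss Q p' q') = trig_gauss Q p2 q2].
  elim: a => [|a [p2 [q2 [tp2 tq2 IH]]]] /=; first by exists p', q'.
  by rewrite IH; exact: partial_trig_gauss_ex.
have [K1 [N1 h1]] := trig_poly_growth tp2.
have [K2 [N2 h2]] := trig_poly_growth tq2.
(* [B N] will bound [(1 + r)^N e^(- Q)]: take [y^N <= N! e^y] at [y = d (1 + r)]; coercivity
   [Q >= d r] leaves the factor [e^d]. *)
pose B N : R := N`!%:R * expR d / d ^+ N.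
exists (`|K1| * B (i + j + N1)%N + `|K2| * B (i + j + N2)%N) => z.
rewrite eqt eqx; set r := z.1 ^+ 2 + z.2 ^+ 2.
have r0 : 0 <= r by rewrite addr_ge0 ?sqr_ge0.
have r1 : 0 <= 1 + r by rewrite addr_ge0.
have expB N : (1 + r) ^+ N * expR (- Q z) <= B N.
  have dr0 : 0 <= d * (1 + r) by rewrite mulr_ge0// ltW.
  rewrite /B ler_pdivlMr ?exprn_gt0//.
  have /(ler_wpM2r (expR_ge0 (- Q z))) := expr_le_fact_expR N dr0.
  rewrite (_ : (d * (1 + r)) ^+ N * _ = (1 + r) ^+ N * expR (- Q z) * d ^+ N); last first.
    by rewrite exprMn; ring.
  move=> /le_trans; apply.
  rewrite -mulrA ler_wpM2l// -expRD ler_expR.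
  by have := dQ z; rewrite -/r; lra.
have absle (x : R) k : x ^+ 2 <= r -> `|x| ^+ k <= (1 + r) ^+ k.
  move=> xr; rewrite lerXn2r ?nnegrE// -[`|x|]mul1r.
  have x2 : `|x| ^+ 2 = x ^+ 2 by rewrite real_normK// num_real.
  have : 0 <= (`|x| - 1) ^+ 2 by exact: sqr_ge0.
  rewrite sqrrB1 x2; nra.
apply: (@le_trans _ _ ((1 + r) ^+ i * (1 + r) ^+ j *
    (`|p2 z| * expR (- Q z) + `|q2 z| * expR (- Q z)))).
  apply: ler_pM; rewrite ?mulr_ge0 ?exprn_ge0 ?sqrtr_ge0//.
    apply: ler_pM; rewrite ?exprn_ge0//; apply: absle; rewrite /r ?lerDl ?lerDr sqr_ge0//.
  apply: le_trans (normc_le _ _) _.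
  by rewrite !normrM !(ger0_norm (expR_ge0 _)).
have fin (K y : R) N : `|y| <= K * (1 + r) ^+ N ->
    (1 + r) ^+ (i + j) * (`|y| * expR (- Q z)) <= `|K| * B (i + j + N)%N.
  move=> yK; apply: le_trans (ler_wpM2l (normr_ge0 K) (expB _)).
  rewrite (exprD _ (i + j)) (_ : `|K| * _ =
    (1 + r) ^+ (i + j) * (`|K| * (1 + r) ^+ N * expR (- Q z))); last by ring.
  rewrite ler_wpM2l ?exprn_ge0// ler_wpM2r ?expR_ge0//.
  by rewrite (le_trans yK)// ler_wpM2r ?exprn_ge0// ler_norm.
by rewrite -exprD mulrDr; apply: lerD; apply: fin.
Qed.

End schwartz_gaussian.

(** * Asymptotic expansions *)

Section expansion.
Context {R : realType}.
Local Notation mu := (@lebesgue_measure R).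
Local Notation intg f := (mu.-integrable [set: R] (EFin \o f)).

Lemma norm_le_small_eq0 (A K : R) :
  (forall s, 0 < s -> s <= 1 -> `|A| <= K * s) -> A = 0.
Proof.
move=> h; apply/eqP; rewrite -normr_le0 leNgt; apply/negP => A0.
have K0 : 0 < K.
  by have := h 1 ltr01 (lexx _); rewrite mulr1; exact: lt_le_trans.
(* At this [s] the bound [K s] is at most half of [|A|]. *)
have s0 : 0 < Num.min 1 (`|A| / (2 * K)).
  by rewrite lt_min ltr01 /= divr_gt0// mulr_gt0.
have s1 : Num.min 1 (`|A| / (2 * K)) <= 1 by rewrite ge_min lexx.
have := h _ s0 s1; apply/negP; rewrite -ltNge.
apply: (@le_lt_trans _ _ (K * (`|A| / (2 * K)))).
  by rewrite ler_pM2l// ge_min lexx orbT.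
rewrite (_ : K * _ = `|A| / 2); last by field; rewrite gt_eqF.
by rewrite ltr_pdivrMr// ltr_pMr// ltr1n.
Qed.

(** Letting [e -> 0] gives [A = 0]; dividing by [e^al] then bounds [|B|] by [K e^(2 - al)]. The
    range of [al] enters through the positivity of both exponents [al] and [2 - al]. *)
Lemma powR_expansion_eq0 (al A B K : R) : 0 < al < 2 ->
  (forall e, 0 < e -> e <= 1 -> `|A - e `^ al * B| <= K * e ^+ 2) -> A = 0 /\ B = 0.
Proof.
move=> /andP[al0 al2] h.
have powR_le1 (s r : R) : 0 < s -> s <= 1 -> 0 <= r -> s `^ r <= 1.
  move=> s0 s1 r0; have <- : 1 `^ r = 1 :> R by rewrite powR1.
  by rewrite ge0_ler_powR ?nnegrE// ltW.
have e2E (e : R) : 0 < e -> e ^+ 2 = e `^ al * e `^ (2 - al).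
  move=> e0; rewrite -powRD; last by apply/implyP => _; rewrite gt_eqF.
  by rewrite subrKC -powR_mulrn ?(ltW e0).
have al20 : 0 < 2 - al by rewrite subr_gt0.
have A0 : A = 0.
  apply: (@norm_le_small_eq0 _ (`|B| + `|K|)) => s s0 s1.
  (* This substitution makes [e^al B] linear in [s], and [e^2 <= s] because [al < 2]; below,
     [s^(1 / (2 - al))] does the same for the second limit. *)
  pose e := s `^ al^-1.
  have e0 : 0 < e by rewrite powR_gt0.
  have e1 : e <= 1 by apply: powR_le1 => //; rewrite invr_ge0 ltW.
  have eal : e `^ al = s by rewrite /e -powRrM mulVf ?gt_eqF// powRr1// ltW.
  have e2 : e ^+ 2 <= s.
    by rewrite e2E// eal ler_piMr ?(ltW s0)// powR_le1// ltW.
  have := h e e0 e1; rewrite eal => hA.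
  rewrite -[A](subrK (s * B)) (le_trans (ler_normD _ _))// mulrDl addrC lerD//.
    by rewrite normrM (gtr0_norm s0) mulrC.
  rewrite (le_trans hA)// (@le_trans _ _ (`|K| * e ^+ 2))//.
    by rewrite ler_wpM2r ?exprn_ge0 ?(ltW e0)// ler_norm.
  by rewrite ler_wpM2l.
split => //.
apply: (@norm_le_small_eq0 _ K) => s s0 s1.
pose e := s `^ (2 - al)^-1.
have e0 : 0 < e by rewrite powR_gt0.
have e1 : e <= 1 by apply: powR_le1 => //; rewrite invr_ge0 ltW.
have eal : e `^ (2 - al) = s by rewrite /e -powRrM mulVf ?gt_eqF// powRr1// ltW.
have := h e e0 e1; rewrite A0 sub0r normrN normrM (gtr0_norm (powR_gt0 _ e0)).
by rewrite e2E// eal mulrCA ler_pM2l// powR_gt0.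
Qed.

(* Expansion of [f] at [0] in powers of one parity: even if [p = 0], odd if [p = 1]. *)
Definition has_expansion (p : nat) (f : R -> R) (t : nat -> R) : Prop :=
  forall J : nat, exists K : R, forall y,
    `|f y - \sum_(j < J.+1) t j * y ^+ (j.*2 + p)| <= K * `|y| ^+ (J.*2 + p).+2.

(** Once the coefficients below [J] vanish, division by [e^(2J + p)] leaves
    [|a_J - e^al b_J| <= K e^2]. The error has order [e^2] because the next power of the same parity
    is two steps away, and [e^al <= 1] keeps the second remainder under control. *)
Lemma has_expansion_powR_eq0 (p : nat) (al : R) (f g : R -> R) (a b : nat -> R) :
  0 < al < 2 -> has_expansion p f a -> has_expansion p g b ->
  (forall e, 0 < e -> f e = e `^ al * g e) -> forall j, a j = 0 /\ b j = 0.
Proof.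
move=> al02 fa gb fg j; elim/ltn_ind: j => J IH.
have /andP[al0 _] := al02.
have [K1 h1] := fa J; have [K2 h2] := gb J.
apply: (@powR_expansion_eq0 al _ _ (`|K1| + `|K2|)) => // e e0 e1.
have sumE (t : nat -> R) : (forall j, (j < J)%N -> t j = 0) ->
    \sum_(j < J.+1) t j * e ^+ (j.*2 + p) = t J * e ^+ (J.*2 + p).
  move=> t0; rewrite big_ord_recr /= big1 ?add0r// => i _.
  by rewrite t0 ?mul0r.
have {}h1 := h1 e; have {}h2 := h2 e.
rewrite sumE in h1; last by move=> i /IH[].
rewrite sumE in h2; last by move=> i /IH[].
rewrite (gtr0_norm e0) in h1 h2.
have eal1 : e `^ al <= 1.
  have <- : 1 `^ al = 1 :> R by rewrite powR1.
  by rewrite ge0_ler_powR ?nnegrE// ltW.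
have eal0 : 0 <= e `^ al by exact: powR_ge0.
have ep : 0 < e ^+ (J.*2 + p) by rewrite exprn_gt0.
rewrite -(ler_pM2r ep) -{1}(gtr0_norm ep) -normrM.
rewrite (_ : (a J - _) * _ = (a J * e ^+ (J.*2 + p) - f e) +
    e `^ al * (g e - b J * e ^+ (J.*2 + p))); last by rewrite fg//; ring.
rewrite (le_trans (ler_normD _ _))// -mulrA -exprD add2n mulrDl lerD//.
  rewrite distrC (le_trans h1)// ler_wpM2r ?exprn_ge0 ?(ltW e0)// ler_norm.
  by [].
rewrite normrM (ger0_norm eal0) (@le_trans _ _ `|g e - b J * e ^+ (J.*2 + p)|)//.
  by rewrite ler_piMl.
by rewrite (le_trans h2)// ler_wpM2r ?exprn_ge0 ?(ltW e0)// ler_norm.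
Qed.

(** The expansion at order [J = 0] already bounds [|f (y x)|] by a combination of [|x|^p] and
    [|x|^(p + 2)], hence the product by two moments of [F]. *)
Lemma integrable_moment_dom (F f : R -> R) (t : nat -> R) (p : nat) (y : R) :
  (forall k, intg (fun x => F x * x ^+ k)) -> measurable_fun [set: R] f ->
  has_expansion p f t -> intg (fun x => F x * f (y * x)).
Proof.
move=> iF mf ft; have [K hK] := ft 0.
have iFabs k : intg (fun x => `|F x * x ^+ k|) by exact: integrable_norm.
have iZ (c : R) k : intg (fun x => c * `|F x * x ^+ k|).
  exact: (integrable_scale _ (iFabs k)).
have mF : measurable_fun [set: R] F.
  have /measurable_EFinP := measurable_int _ (iF 0).
  by rewrite (_ : (fun x => _) = F)//; apply/funext => x; rewrite expr0 mulr1.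
have idom : intg (fun x => `|t 0 * y ^+ p| * `|F x * x ^+ p| +
    `|K * `|y| ^+ p.+2| * `|F x * x ^+ p.+2|).
  exact: (integrable_add (iZ _ _) (iZ _ _)).
apply: (le_integrable measurableT _ _ idom).
  apply/measurable_EFinP; apply: measurable_funM => //.
  by apply: measurableT_comp => //; exact: measurable_funM.
move=> x _ /=; rewrite lee_fin normrM.
rewrite [leRHS]ger0_norm; last by rewrite addr_ge0.
have := hK (y * x); rewrite big_ord1 double0 add0n => h.
have {}h : `|f (y * x)| <= `|t 0%N * y ^+ p| * `|x ^+ p| + `|K * `|y| ^+ p.+2| * `|x ^+ p.+2|.
  rewrite -[f _](subrK (t 0%N * (y * x) ^+ p)) (le_trans (ler_normD _ _))// addrC lerD//.
    by rewrite -normrM exprMn mulrA.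
  rewrite (le_trans h)// normrM exprMn [in leRHS]normrM (normrX _ x) (normrX _ `|y|) normr_id.
  by rewrite mulrA ler_wpM2r ?exprn_ge0// ler_wpM2r ?exprn_ge0// ler_norm.
rewrite (le_trans (ler_wpM2l (normr_ge0 (F x)) h))//.
by rewrite [`|F x * x ^+ p|]normrM [`|F x * x ^+ p.+2|]normrM mulrDr
  [X in _ <= X + _]mulrCA [X in _ <= _ + X]mulrCA.
Qed.

(** The remainder bound of [f] holds at every point, not only near [0], so it may be integrated at
    [y x]; the new constant is an absolute moment of [F]. *)
Lemma has_expansion_integral (F f : R -> R) (t : nat -> R) (p : nat) :
  (forall k, intg (fun x => F x * x ^+ k)) -> measurable_fun [set: R] f ->
  has_expansion p f t ->
  has_expansion p (fun y => \int[mu]_x (F x * f (y * x)))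
    (fun j => t j * \int[mu]_x (F x * x ^+ (j.*2 + p))).
Proof.
move=> iF mf ft J; have [K hK] := ft J.
exists (`|K| * \int[mu]_x `|F x * x ^+ (J.*2 + p).+2|) => y.
have iFf : intg (fun x => F x * f (y * x)) by exact: integrable_moment_dom ft.
have isum n : intg (fun x => F x * \sum_(j < n) t j * (y * x) ^+ (j.*2 + p)) /\
    \int[mu]_x (F x * \sum_(j < n) t j * (y * x) ^+ (j.*2 + p)) =
    \sum_(j < n) t j * (\int[mu]_x (F x * x ^+ (j.*2 + p))) * y ^+ (j.*2 + p).
  elim: n => [|n [i1 e1]].
    split.
      apply: eq_integrable (integrable0 _ _) => // x _.
      by rewrite /= big_ord0 mulr0.
    rewrite big_ord0; under eq_Rintegral do rewrite big_ord0 mulr0.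
    by rewrite Rintegral_cst// mul0r.
  have i2 : intg (fun x => (t n * y ^+ (n.*2 + p)) * (F x * x ^+ (n.*2 + p))).
    exact: (integrable_scale _ (iF _)).
  have e x : F x * \sum_(j < n.+1) t j * (y * x) ^+ (j.*2 + p) =
      F x * (\sum_(j < n) t j * (y * x) ^+ (j.*2 + p)) +
      (t n * y ^+ (n.*2 + p)) * (F x * x ^+ (n.*2 + p)).
    by rewrite big_ord_recr /= exprMn; ring.
  split.
    apply: eq_integrable (integrableD measurableT i1 i2) => // x _ /=.
    by rewrite e EFinD.
  under eq_Rintegral do rewrite e.
  by rewrite RintegralD// e1 RintegralZl// big_ord_recr /=; congr (_ + _); ring.
have [i1 e1] := isum J.+1.
have iabs : intg (fun x => `|F x * x ^+ (J.*2 + p).+2|) by exact: integrable_norm.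
have iZ : intg (fun x => (`|K| * `|y| ^+ (J.*2 + p).+2) * `|F x * x ^+ (J.*2 + p).+2|).
  exact: (integrable_scale _ iabs).
have idiff : intg (fun x => F x * f (y * x) - F x * \sum_(j < J.+1) t j * (y * x) ^+ (j.*2 + p)).
  exact: (integrable_sub iFf i1).
rewrite -e1 -RintegralB//.
apply: (le_trans (le_normr_Rintegral measurableT idiff)).
rewrite mulrAC -RintegralZl//; apply: le_Rintegral => //.
  exact: integrable_norm.
move=> x _; rewrite -mulrBr normrM.
apply: le_trans (ler_wpM2l (normr_ge0 _) (hK _)) _.
rewrite normrM exprMn [in leRHS]normrM [in leRHS]normrX.
rewrite (_ : `|K| * _ * _ = `|F x| *
  (`|K| * (`|y| ^+ (J.*2 + p).+2 * `|x| ^+ (J.*2 + p).+2))); last by ring.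
apply: ler_wpM2l => //; apply: ler_wpM2r; last exact: ler_norm.
by rewrite mulr_ge0 ?exprn_ge0.
Qed.

(** * Taylor expansions of the cosine, the sine and the Gaussian *)

(** The remainder vanishes at [0] and its derivative is the remainder, one order lower, of the
    shifted family; the mean value theorem then contributes one factor [x]. Only the power of [x]
    matters later, hence the crude constant [1]. *)
Lemma taylor_bound (F : nat -> R -> R) (n : nat) :
  (forall i x, is_derive x (1 : R) (F i) (F i.+1 x)) ->
  (forall i x, 0 <= x -> `|F i x| <= 1) ->
  forall x, 0 <= x -> `|F 0%N x - \sum_(i < n) F i 0 / i`!%:R * x ^+ i| <= x ^+ n.
Proof.
elim: n F => [|n IH] F dF bF x x0.
  by rewrite big_ord0 subr0 expr0 bF.
pose G := fun x => F 0%N x - \sum_(i < n.+1) F i 0 / i`!%:R * x ^+ i.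
pose g := fun x => F 1%N x - \sum_(i < n) F i.+1 0 / i`!%:R * x ^+ i.
have gb y : 0 <= y -> `|g y| <= y ^+ n.
  by move=> y0; apply: (IH (fun i => F i.+1)) => // i z z0; exact: bF.
have dG y : is_derive y (1 : R) G (g y).
  have -> : G = (F 0%N - \sum_(i < n.+1) (fun x => F i 0 / i`!%:R * x ^+ i)).
    by apply/funext => z; rewrite /G /= fct_sumE.
  have ds : is_derive y (1 : R) (\sum_(i < n.+1) (fun x => F i 0 / i`!%:R * x ^+ i))
     (\sum_(i < n.+1) F i 0 / i`!%:R * (i%:R * y ^+ i.-1)).
    apply: is_derive_sum => i.
    have dX : is_derive y (1 : R) (fun x : R => x ^+ i) (i%:R * y ^+ i.-1).
      apply: DeriveDef; first exact: exprn_derivable.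
      by rewrite exp_derive /GRing.scale /= mulr1.
    by apply: is_derive_eq; rewrite /GRing.scale /=; ring.
  have d0 := dF 0%N y.
  apply: is_derive_eq; rewrite /g; congr (_ - _).
  rewrite big_ord_recl /= mul0r mulr0 add0r; apply: eq_bigr => i _.
  rewrite /bump /= add1n factS natrM.
  have : i.+1%:R != 0 :> R by rewrite pnatr_eq0.
  have : i`!%:R != 0 :> R by rewrite pnatr_eq0 -lt0n fact_gt0.
  rewrite add0n; move: (i.+1%:R) (i`!%:R) (F i.+1 0) (y ^+ i) => u v w r u0 v0.
  by field; rewrite u0 v0.
have G0 : G 0 = 0.
  rewrite /G big_ord_recl big1 ?addr0 /= ?fact0 ?expr0 ?divr1 ?mulr1 ?subrr//.
  by move=> i _; rewrite expr0n mulr0.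
move: x0; rewrite le_eqVlt => /orP[/eqP <-|x0].
  by rewrite -/(G 0) G0 normr0.
have [|y] := @MVT_segment R G g 0 x (ltW x0).
  apply: continuous_subspaceT => y.
  by apply: differentiable_continuous; apply/derivable1_diffP; case: (dG y).
rewrite in_itv /= => /andP[y0 yx]; rewrite G0 !subr0 => Gx.
rewrite -/(G x) Gx normrM (gtr0_norm x0) exprSr ler_wpM2r ?(ltW x0)//.
by rewrite (le_trans (gb y y0))// lerXn2r ?nnegrE// ltW.
Qed.

(** The successive derivatives of [cos], with signs repeating as [+ - - +]; for [sin] below the
    signs repeat as [+ + - -]. *)
Definition cos_derivs (i : nat) (x : R) : R :=
  (-1) ^+ uphalf i * (if odd i then sin x else cos x).

Definition sin_derivs (i : nat) (x : R) : R :=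
  (-1) ^+ i./2 * (if odd i then cos x else sin x).

Definition cos_coef (j : nat) : R := (-1) ^+ j / (j.*2)`!%:R.

Definition sin_coef (j : nat) : R := (-1) ^+ j / (j.*2.+1)`!%:R.

Lemma is_derive_cos_derivs i x : is_derive x (1 : R) (cos_derivs i) (cos_derivs i.+1 x).
Proof.
rewrite /cos_derivs /= uphalf_half; case: (boolP (odd i)) => oi /=.
  by rewrite add1n; apply: is_derive_eq; rewrite /GRing.scale /=; ring.
by rewrite add0n; apply: is_derive_eq; rewrite /GRing.scale /= exprS; ring.
Qed.

Lemma is_derive_sin_derivs i x : is_derive x (1 : R) (sin_derivs i) (sin_derivs i.+1 x).
Proof.
rewrite /sin_derivs /= uphalf_half; case: (boolP (odd i)) => oi /=.
  by rewrite add1n exprS; apply: is_derive_eq; rewrite /GRing.scale /=; ring.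
by rewrite add0n; apply: is_derive_eq; rewrite /GRing.scale /=; ring.
Qed.

Lemma has_expansion_cos : has_expansion 0 cos cos_coef.
Proof.
move=> J; exists 1 => y.
have Fb i x : 0 <= x -> `|cos_derivs i x| <= 1.
  move=> _; rewrite /cos_derivs normrM normrX normrN1 expr1n mul1r.
  by case: ifP => _; [exact: sin_max|exact: cos_max].
(* By parity the one-sided bound may be used at [|y|]. The odd terms vanish, so order [2J + 2]
   yields exactly the required remainder. *)
have := taylor_bound J.+1.*2 is_derive_cos_derivs Fb (normr_ge0 y).
rewrite {1}/cos_derivs /= expr0 mul1r cos_norm mul1r addn0.
rewrite (_ : \sum_(i < _) _ = \sum_(j < J.+1) cos_coef j * y ^+ (j.*2 + 0))//.
elim: (J.+1) => [|n IH]; first by rewrite !big_ord0.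
rewrite doubleS !big_ord_recr /= -IH -addrA; congr (_ + _).
rewrite /cos_derivs /= odd_double /= sin0 cos0 uphalf_double !mulr0 !mul0r addr0.
by rewrite mulr1 addn0 /cos_coef -mul2n !exprM real_normK ?num_real.
Qed.

Lemma has_expansion_sin : has_expansion 1 sin sin_coef.
Proof.
move=> J; exists 1 => y.
have Fb i x : 0 <= x -> `|sin_derivs i x| <= 1.
  move=> _; rewrite /sin_derivs normrM normrX normrN1 expr1n mul1r.
  by case: ifP => _; [exact: cos_max|exact: sin_max].
(* The Taylor bound is one-sided, and [sin] and its partial sums are odd. *)
wlog y0 : y / 0 <= y.
  move=> h; have [|y0] := leP 0 y; first exact: h.
  have := h (- y); rewrite oppr_ge0 (ltW y0) => /(_ isT).
  rewrite sinN (_ : \sum_(_ < _) _ = - \sum_(j < J.+1) sin_coef j * y ^+ (j.*2 + 1)).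
    by rewrite -opprD !normrN.
  rewrite -sumrN; apply: eq_bigr => i _.
  by rewrite addn1 exprNn -signr_odd /= odd_double expr1; ring.
have := taylor_bound J.+1.*2.+1 is_derive_sin_derivs Fb y0.
rewrite {1}/sin_derivs /= expr0 !mul1r (ger0_norm y0) addn1.
rewrite (_ : \sum_(i < _) _ = \sum_(j < J.+1) sin_coef j * y ^+ (j.*2 + 1))//.
elim: (J.+1) => [|n IH].
  by rewrite big_ord1 big_ord0 /sin_derivs /= sin0 mulr0 !mul0r.
rewrite [RHS]big_ord_recr doubleS -IH big_ord_recr [X in X + _ = _]big_ord_recr -addrA.
congr (_ + _); rewrite /sin_derivs /= odd_double /= sin0 cos0 uphalf_double !mulr0 !mul0r addr0.
by rewrite mulr1 addn1 /sin_coef.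
Qed.

(** The Taylor bound for [e^(- x)] taken at [x = y^2 / 2], with the factor [1 / 2^J] of the
    remainder dropped. *)
Lemma gauss_expansion (J : nat) (y : R) :
  `|gauss y - \sum_(j < J) ((-1) ^+ j / j`!%:R / 2 ^+ j) * y ^+ j.*2| <= `|y| ^+ J.*2.
Proof.
pose F (i : nat) (x : R) : R := (-1) ^+ i * expR (- x).
have dF i x : is_derive x (1 : R) (F i) (F i.+1 x).
  by rewrite /F; apply: is_derive_eq; rewrite /GRing.scale /= exprS; ring.
have Fb i x : 0 <= x -> `|F i x| <= 1.
  move=> x0; rewrite /F normrM normrX normrN1 expr1n mul1r ger0_norm ?expR_ge0//.
  by rewrite expR_le1 oppr_le0.
have y2 : 0 <= y ^+ 2 / 2 by rewrite divr_ge0 ?sqr_ge0.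
have := taylor_bound J dF Fb y2.
rewrite {1}/F expr0 mul1r -/(gauss y).
rewrite (eq_bigr (fun j : 'I_J => ((-1) ^+ j / j`!%:R / 2 ^+ j) * y ^+ j.*2)); last first.
  by move=> j _; rewrite /F oppr0 expR0 mulr1 expr_div_n -exprM mul2n -!mulrA [_^-1 * y ^+ _]mulrC.
move=> /le_trans; apply; rewrite -mul2n exprM real_normK ?num_real//.
by rewrite lerXn2r ?nnegrE ?sqr_ge0// ler_pdivrMr// ler_peMr ?sqr_ge0// ler1n.
Qed.

Lemma has_expansion_gauss1 : exists t, has_expansion 1 (fun y => y * gauss y) t.
Proof.
exists (fun j => (-1) ^+ j / j`!%:R / 2 ^+ j) => J; exists 1 => y.
rewrite (_ : \sum_(_ < _) _ = y * \sum_(j < J.+1) ((-1) ^+ j / j`!%:R / 2 ^+ j) * y ^+ j.*2).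
  rewrite -mulrBr normrM mul1r addn1 exprS ler_wpM2l//.
  exact: gauss_expansion.
rewrite mulr_sumr; apply: eq_bigr => j _.
by rewrite addn1 exprS mulrCA.
Qed.

Lemma has_expansion_gauss2 : exists t, has_expansion 0 (fun y => (1 - y ^+ 2) * gauss y) t.
Proof.
pose c (j : nat) : R := (-1) ^+ j / j`!%:R / 2 ^+ j.
(* Multiplication by [- y^2] shifts the coefficients by one, with nothing to subtract at [j = 0].
   The constant [2] adds up the remainders of the two resulting Gaussian expansions. *)
exists (fun j => c j - (if j is i.+1 then c i else 0)) => J; exists 2 => y.
have -> : \sum_(j < J.+1) (c j - (if val j is i.+1 then c i else 0)) * y ^+ (j.*2 + 0) =
    \sum_(j < J.+1) c j * y ^+ j.*2 - y ^+ 2 * \sum_(j < J) c j * y ^+ j.*2.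
  rewrite big_ord_recl [in RHS]big_ord_recl /= subr0 -addrA; congr (_ + _).
  rewrite mulr_sumr -sumrB; apply: eq_bigr => i _.
  by rewrite /bump /= add1n addn0 doubleS !exprS; ring.
rewrite mulrBl mul1r (_ : gauss y - _ - _ =
    (gauss y - \sum_(j < J.+1) c j * y ^+ j.*2) -
    y ^+ 2 * (gauss y - \sum_(j < J) c j * y ^+ j.*2)); last by ring.
rewrite (le_trans (ler_normB _ _))// mulr_natl mulr2n lerD// addn0.
  exact: gauss_expansion.
by rewrite normrM normrX -[J.*2.+2]add2n exprD ler_wpM2l ?exprn_ge0// gauss_expansion.
Qed.

End expansion.

(** * Vanishing moments *)

Section moments.
Context {R : realType}.
Local Notation mu := (@lebesgue_measure R).
Local Notation intg f := (mu.-integrable [set: R] (EFin \o f)).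

Definition exp_poly (n : nat) (q : {poly R}) : {poly R} :=
  \sum_(0 <= k < n) k`!%:R^-1 *: q ^+ k.

Lemma horner_exp_poly n q x : (exp_poly n q).[x] = series (exp_coeff q.[x]) n.
Proof.
rewrite /exp_poly /series /= horner_sum; apply: eq_bigr => k _.
by rewrite hornerZ horner_exp mulrC.
Qed.

Lemma cvg_exp_poly q x : (fun n => (exp_poly n q).[x]) @ \oo --> expR q.[x].
Proof.
under eq_fun do rewrite horner_exp_poly.
exact: is_cvg_series_exp_coeff.
Qed.

Lemma exp_poly_bound n q x B : `|q.[x]| <= B -> `|(exp_poly n q).[x]| <= expR B.
Proof.
move=> qB; rewrite horner_exp_poly.
apply: (@le_trans _ _ (series (exp_coeff B) n)).
  rewrite /series /= (le_trans (ler_norm_sum _ _ _))//; apply: ler_sum => k _.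
  rewrite /exp_coeff /= normrM normrX [`|_^-1|]ger0_norm// ler_wpM2r ?invr_ge0//.
  by rewrite lerXn2r ?nnegrE// (le_trans _ qB).
apply: nondecreasing_cvgn_le; last exact: is_cvg_series_exp_coeff.
apply: nondecreasing_series => k _ _ /=.
by apply: exp_coeff_ge0; rewrite (le_trans _ qB).
Qed.

Lemma horner_bound (q : {poly R}) (M : R) :
  exists B, forall x, `|x| <= M -> `|q.[x]| <= B.
Proof.
exists (\sum_(i < size q) `|q`_i| * M ^+ i) => x xM.
rewrite horner_coef (le_trans (ler_norm_sum _ _ _))//; apply: ler_sum => i _.
by rewrite normrM normrX ler_wpM2l// lerXn2r ?nnegrE// (le_trans _ xM).
Qed.

Section vanishing_moments.
Variables (g : R -> R) (M : R).
Hypotheses (ig : intg g) (gM : forall x, M < `|x| -> g x = 0).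

Let mg : measurable_fun [set: R] g.
Proof. by have /measurable_EFinP := measurable_int _ ig. Qed.

Lemma integrable_mul_bounded_on (h : R -> R) (B : R) : measurable_fun [set: R] h ->
  (forall x, `|x| <= M -> `|h x| <= B) -> intg (fun x => g x * h x).
Proof.
move=> mh hB.
have iB : intg (fun x => `|B| * `|g x|).
  have := integrable_norm ig => ing.
  exact: (integrable_scale _ ing).
apply: (le_integrable measurableT _ _ iB).
  by apply/measurable_EFinP; exact: measurable_funM.
move=> x _ /=; rewrite lee_fin normrM [leRHS]ger0_norm ?mulr_ge0//.
have [xM|Mx] := leP `|x| M; last by rewrite gM// normr0 mul0r mulr0.
by rewrite mulrC ler_wpM2r// (le_trans (hB x xM))// ler_norm.
Qed.

(** Dominated convergence in which the bound is asked only for [|x| <= M], as [g] vanishes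
    elsewhere. This admits exponentials of polynomials, which may be unbounded on the line. *)
Lemma Rintegral_mul_bounded_cvg0 (h_ : nat -> R -> R) (h : R -> R) (B : R) :
  (forall n, measurable_fun [set: R] (h_ n)) ->
  (forall n x, `|x| <= M -> `|h_ n x| <= B) ->
  (forall x, h_ ^~ x @ \oo --> h x) ->
  (forall n, \int[mu]_x (g x * h_ n x) = 0) -> \int[mu]_x (g x * h x) = 0.
Proof.
move=> mh_ h_B h_h int0.
have : (fun n => \int[mu]_x (g x * h_ n x)) @ \oo --> \int[mu]_x (g x * h x).
  apply: (@dominated_cvg_Rintegral _ _ _ (fun x => `|B| * `|g x|)).
  - by move=> n; exact: measurable_funM.
  - by move=> x; apply: cvgM; [exact: cvg_cst|exact: h_h].
  - have := integrable_norm ig => ing.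
    exact: (integrable_scale _ ing).
  - move=> n x; rewrite normrM.
    have [xM|Mx] := leP `|x| M; last by rewrite gM// normr0 mul0r mulr0.
    by rewrite mulrC ler_wpM2r// (le_trans (h_B n x xM))// ler_norm.
under eq_fun do rewrite int0.
by move=> h0; apply/esym; apply: (cvg_unique _ (cvg_cst _) h0).
Qed.

Hypothesis moments0 : forall k, \int[mu]_x (g x * x ^+ k) = 0.

Let measurable_horner (q : {poly R}) : measurable_fun [set: R] (horner q).
Proof. by apply: continuous_measurable_fun; exact: continuous_horner. Qed.

Let integrable_mul_horner (q : {poly R}) : intg (fun x => g x * q.[x]).
Proof.
have [B qB] := horner_bound q M.
exact: integrable_mul_bounded_on qB.
Qed.

Lemma Rintegral_mul_horner0 (q : {poly R}) : \int[mu]_x (g x * q.[x]) = 0.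
Proof.
suff: forall n, \int[mu]_x (g x * (\poly_(i < n) q`_i).[x]) = 0.
  by move=> /(_ (size q)); rewrite coefK.
elim=> [|n IH].
  under eq_Rintegral do rewrite horner_poly big_ord0 mulr0.
  by rewrite Rintegral_cst// mul0r.
have igX : intg (fun x => g x * x ^+ n).
  have := integrable_mul_horner 'X^n; apply: eq_integrable => // x _ /=.
  by rewrite hornerXn.
have igZ : intg (fun x => q`_n * (g x * x ^+ n)).
  exact: (integrable_scale _ igX).
under eq_Rintegral do rewrite horner_poly big_ord_recr /= -horner_poly mulrDr [X in _ + X]mulrCA.
by rewrite RintegralD// IH add0r RintegralZl// moments0 mulr0.
Qed.

Lemma Rintegral_mul_expR0 (q : {poly R}) : \int[mu]_x (g x * expR q.[x]) = 0.
Proof.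
have [B qB] := horner_bound q M.
apply: (@Rintegral_mul_bounded_cvg0 (fun n => horner (exp_poly n q)) _ (expR B)).
- by move=> n; exact: measurable_horner.
- by move=> n x xM; apply: exp_poly_bound; exact: qB.
- by move=> x; exact: cvg_exp_poly.
- by move=> n; exact: Rintegral_mul_horner0.
Qed.

(** The approximants [expR (- exp_poly n q)] are themselves exponentials of polynomials, so the
    previous lemma covers them. The double exponential is wanted because, for increasing [q], it
    descends from values near [1] to values near [0] like the indicator of a half-line. *)
Lemma Rintegral_mul_expR_expR0 (q : {poly R}) :
  \int[mu]_x (g x * expR (- expR q.[x])) = 0.
Proof.
have [B qB] := horner_bound q M.
apply: (@Rintegral_mul_bounded_cvg0 (fun n x => expR (- (exp_poly n q).[x])) _ (expR (expR B))).
- by move=> n; apply: measurableT_comp => //; exact: measurableT_comp.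
- move=> n x xM; rewrite ger0_norm ?expR_ge0// ler_expR.
  by rewrite (le_trans (ler_norm _))// normrN exp_poly_bound// qB.
- move=> x; apply: continuous_cvg; first exact: continuous_expR.
  by apply: cvgN; exact: cvg_exp_poly.
- move=> n; rewrite -[RHS](Rintegral_mul_expR0 (- exp_poly n q)).
  by apply: eq_Rintegral => x _; rewrite hornerN.
Qed.

(* The term [- n] makes the limit [1] at [x = y] as well. *)
Lemma cvg_expR_expR_step (x y : R) :
  (fun n : nat => expR (- expR (n%:R ^+ 2 * (x - y) - n%:R))) @ \oo -->
  ((x <= y)%R%:R : R).
Proof.
have [xy|yx] := lerP x y.
  rewrite -[X in _ --> X]expR0; apply: continuous_cvg; first exact: continuous_expR.
  rewrite -oppr0; apply: cvgN.
  apply: (@squeeze_cvgr _ _ _ _ (cst 0) (fun n : nat => expR (- n%:R))).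
  - apply: nearW => n; rewrite expR_ge0 /= ler_expR gerDr.
    by rewrite mulr_ge0_le0 ?sqr_ge0// subr_le0.
  - exact: cvg_cst.
  - exact: cvgn_expR.
apply: (@squeeze_cvgr _ _ _ _ (cst 0) (fun n : nat => expR (- n%:R))).
- near=> n; rewrite expR_ge0 /= ler_expR lerN2.
  apply: le_trans (expR_ge1Dx _).
  have nd : 2 <= n%:R * (x - y).
    rewrite -ler_pdivrMr ?subr_gt0//.
    near: n; exact: nbhs_infty_ger.
  rewrite expr2 -mulrA.
  have n0 : 0 <= n%:R :> R by [].
  have := ler_wpM2l n0 nd; lra.
- exact: cvg_cst.
- exact: cvgn_expR.
Unshelve. all: by end_near. Qed.

(** For [q = n^2 (X - y) - n] the double exponentials stay in [[0, 1]] and tend to the indicator of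
    []-oo, y]]. So the primitive of [g] from [-oo] is zero, and almost everywhere [g] is its
    derivative. *)
Lemma vanishing_moments_ae0 : {ae mu, forall x, g x = 0}.
Proof.
have int0 y : \int[mu]_(x in `]-oo, y]) g x = 0.
  rewrite Rintegral_mkcond.
  have : \int[mu]_x (g x * (x <= y)%R%:R) = 0.
    apply: (@Rintegral_mul_bounded_cvg0
        (fun n x => expR (- expR (n%:R ^+ 2 * (x - y) - n%:R))) _ 1).
    - move=> n; apply: measurableT_comp => //; apply: measurableT_comp => //.
      apply: measurableT_comp => //; apply: measurable_funB => //.
      by apply: measurable_funM => //; exact: measurable_funB.
    - move=> n x _; rewrite ger0_norm ?expR_ge0// expR_le1 oppr_le0; exact: expR_ge0.
    - by move=> x; exact: cvg_expR_expR_step.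
    - move=> n; rewrite -[RHS](Rintegral_mul_expR_expR0 ((n%:R ^+ 2)%:P * ('X - y%:P) - n%:R%:P)).
      by apply: eq_Rintegral => x _; rewrite !hornerE.
  move=> <-; apply: eq_Rintegral => x _; rewrite patchE.
  case: ifPn; first by rewrite inE /= in_itv /= => ->; rewrite mulr1.
  by rewrite notin_setE /= in_itv /= => /negP/negbTE ->; rewrite mulr0.
have igy y : mu.-integrable `]-oo, y] (EFin \o g).
  exact: integrableS ig.
have lg : locally_integrable [set: R] g by apply: open_integrable_locally => //; exact: openT.
have := FTC1Ny igy lg; apply: filterS; first exact: (ae_filter_ringOfSetsType mu).
move=> x [_ <-].
rewrite (_ : (fun x0 => _) = cst 0) ?derive1_cst//.
by apply/funext => y; exact: int0.
Qed.

End vanishing_moments.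

End moments.

(** * Test functions *)

Section test_functions.
Local Open Scope complex_scope.
Context {R : realType}.
Local Notation mu := (@lebesgue_measure R).
Local Notation intg f := (mu.-integrable [set: R] (EFin \o f)).
Local Notation plane := (R * R)%type.

Lemma trig_polyX (p : plane -> R) (i : nat) : trig_poly p -> trig_poly (fun z => p z ^+ i).
Proof.
move=> tp; elim: i => [|i IH].
  rewrite (_ : (fun z => _) = fun=> 1); first exact: trig_poly_cst.
  by apply/funext => z; rewrite expr0.
rewrite (_ : (fun z => _) = fun z => p z * p z ^+ i); first exact: trig_polyM.
by apply/funext => z; rewrite exprS.
Qed.

Lemma is_derive_fst (v z : plane) : is_derive z v (@fst R R) v.1.
Proof.
apply: DeriveDef; last exact: derive_fst.
by apply: diff_derivable; exact: differentiable_fst.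
Qed.

Lemma is_derive_snd (v z : plane) : is_derive z v (@snd R R) v.2.
Proof.
apply: DeriveDef; last exact: derive_snd.
by apply: diff_derivable; exact: differentiable_snd.
Qed.

(* [phi_test (x, t) = gauss_mass * profile (eps (x - c t)) * gauss t] and
   [psi_test (xi, t) = (u + i v) (xi / eps)^i gauss (xi / eps) e^(i c t xi) gauss t].
   The parameters are later chosen so that [phi_test] is an [x]-primitive of the
   [x]-Fourier transform of [psi_test]. *)
Variables (c eps b d u v : R) (i : nat).
Hypothesis eps0 : 0 < eps.

Let y (z : plane) : R := eps * (z.1 - c * z.2).

Definition phi_quad (z : plane) : R := y z ^+ 2 / 2 + z.2 ^+ 2 / 2.

Definition phi_amp (z : plane) : R := gauss_mass * (b * y z + d).

Definition phi_test : plane -> R[i] := trig_gauss phi_quad phi_amp (fun=> 0).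

Definition psi_quad (z : plane) : R := (z.1 / eps) ^+ 2 / 2 + z.2 ^+ 2 / 2.

Definition psi_re (z : plane) : R :=
  (z.1 / eps) ^+ i * (u * cos (c * z.2 * z.1) - v * sin (c * z.2 * z.1)).

Definition psi_im (z : plane) : R :=
  (z.1 / eps) ^+ i * (u * sin (c * z.2 * z.1) + v * cos (c * z.2 * z.1)).

Definition psi_test : plane -> R[i] := trig_gauss psi_quad psi_re psi_im.

Let trig_poly_y : trig_poly y.
Proof.
apply: trig_polyM; first exact: trig_poly_cst.
apply: trig_polyB; first exact: trig_poly_fst.
by apply: trig_polyM; [exact: trig_poly_cst|exact: trig_poly_snd].
Qed.

Lemma trig_poly_phi_quad : trig_poly phi_quad.
Proof.
by apply: trig_polyD; apply: trig_polyM; try exact: trig_poly_cst;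
  apply: trig_polyX => //; exact: trig_poly_snd.
Qed.

Lemma trig_poly_phi_amp : trig_poly phi_amp.
Proof.
apply: trig_polyM; first exact: trig_poly_cst.
apply: trig_polyD; last exact: trig_poly_cst.
by apply: trig_polyM => //; exact: trig_poly_cst.
Qed.

Let trig_poly_fst_eps : trig_poly (fun z => z.1 / eps).
Proof. by apply: trig_polyM; [exact: trig_poly_fst|exact: trig_poly_cst]. Qed.

Let trig_poly_phase : trig_poly (fun z => c * z.2 * z.1).
Proof.
apply: trig_polyM; last exact: trig_poly_fst.
by apply: trig_polyM; [exact: trig_poly_cst|exact: trig_poly_snd].
Qed.

Lemma trig_poly_psi_quad : trig_poly psi_quad.
Proof.
by apply: trig_polyD; apply: trig_polyM; try exact: trig_poly_cst;
  apply: trig_polyX => //; exact: trig_poly_snd.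
Qed.

Lemma trig_poly_psi_re : trig_poly psi_re.
Proof.
apply: trig_polyM; first exact: trig_polyX.
apply: trig_polyB; apply: trig_polyM; try exact: trig_poly_cst.
  exact: trig_poly_cos.
exact: trig_poly_sin.
Qed.

Lemma trig_poly_psi_im : trig_poly psi_im.
Proof.
apply: trig_polyM; first exact: trig_polyX.
apply: trig_polyD; apply: trig_polyM; try exact: trig_poly_cst.
  exact: trig_poly_sin.
exact: trig_poly_cos.
Qed.

Lemma schwartz_phi_test : schwartz phi_test.
Proof.
have e2 : 0 < eps ^+ 2 by rewrite exprn_gt0.
have c2 : 0 <= c ^+ 2 by exact: sqr_ge0.
(* With [x = w + c t] one has [D (x^2 + t^2) <= 2 D w^2 + D (1 + 2 c^2) t^2]. The two entries of the
   minimum bring these terms below [eps^2 w^2 / 2] and [t^2 / 2], the two terms of [phi_quad]. *)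
pose D := Num.min (eps ^+ 2 / 4) (2 * (1 + 2 * c ^+ 2))^-1.
have D0 : 0 < D.
  rewrite lt_min divr_gt0//= invr_gt0 mulr_gt0// (lt_le_trans ltr01)// lerDl.
  by rewrite mulr_ge0.
have D1 : D <= eps ^+ 2 / 4 by rewrite ge_min lexx.
have D2 : D * (1 + 2 * c ^+ 2) <= 1 / 2.
  have c0 : 0 < 1 + 2 * c ^+ 2 by rewrite (lt_le_trans ltr01)// lerDl mulr_ge0.
  rewrite -ler_pdivlMr// (_ : 1 / 2 / _ = (2 * (1 + 2 * c ^+ 2))^-1).
    by rewrite ge_min lexx orbT.
  by rewrite mul1r invfM.
apply: (@schwartz_trig_gauss _ _ _ _ D) => //.
- exact: trig_poly_phi_quad.
- exact: trig_poly_phi_amp.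
- exact: trig_poly_cst.
move=> [x t]; rewrite /phi_quad /y /=.
set w := x - c * t; have -> : x = w + c * t by rewrite /w subrK.
have w2 := sqr_ge0 w; have t2 := sqr_ge0 t.
have le1 : (w + c * t) ^+ 2 <= 2 * w ^+ 2 + 2 * c ^+ 2 * t ^+ 2.
  have := sqr_ge0 (w - c * t); rewrite !expr2; lra.
apply: (@le_trans _ _ (D * (2 * w ^+ 2) + D * (1 + 2 * c ^+ 2) * t ^+ 2)).
  rewrite -[D * (1 + _) * _]mulrA -mulrDr ler_wpM2l ?(ltW D0)//; lra.
rewrite exprMn; apply: lerD.
  by rewrite mulrA [leRHS]mulrAC ler_wpM2r//; lra.
by rewrite [leRHS]mulrC ler_wpM2r// -[leRHS]mul1r.
Qed.

Lemma schwartz_psi_test : schwartz psi_test.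
Proof.
pose D := Num.min (eps^-1 ^+ 2 / 2) (1 / 2).
have D0 : 0 < D by rewrite lt_min; apply/andP; split; rewrite divr_gt0 ?exprn_gt0 ?invr_gt0.
apply: (@schwartz_trig_gauss _ _ _ _ D) => //.
- exact: trig_poly_psi_quad.
- exact: trig_poly_psi_re.
- exact: trig_poly_psi_im.
move=> [x t]; rewrite /psi_quad /= mulrDr; apply: lerD.
  rewrite exprMn -mulrA mulrC ler_wpM2l ?sqr_ge0//.
  by rewrite /D ge_min lexx.
rewrite mulrC ler_wpM2l ?sqr_ge0// -[_^-1]mul1r.
by rewrite /D ge_min lexx orbT.
Qed.

Definition profile (x : R) : R := (b * x + d) * gauss x.

Definition dprofile (x : R) : R := (b - x * (b * x + d)) * gauss x.

Let expR_phi_quad z : expR (- phi_quad z) = gauss (y z) * gauss z.2.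
Proof. by rewrite /phi_quad opprD expRD. Qed.

Let is_derive_y w z : is_derive z w y (eps * (w.1 - c * w.2)).
Proof.
have ? := is_derive_fst w z; have ? := is_derive_snd w z.
by apply: is_derive_eq; rewrite /GRing.scale /=; ring.
Qed.

Let derive_phi_amp w z : 'D_w phi_amp z = gauss_mass * b * (eps * (w.1 - c * w.2)).
Proof.
have ? := is_derive_y w z.
by apply: derive_val; apply: is_derive_eq; rewrite /GRing.scale /=; ring.
Qed.

Let derive_phi_quad w z : 'D_w phi_quad z = y z * (eps * (w.1 - c * w.2)) + z.2 * w.2.
Proof.
have ? := is_derive_y w z; have ? := is_derive_snd w z.
by apply: derive_val; apply: is_derive_eq; rewrite /GRing.scale /=; field.
Qed.

Let partial_phi_test w z : partial w phi_test z =
  (gauss_mass * (eps * (w.1 - c * w.2) * dprofile (y z) * gauss z.2 -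
    w.2 * profile (y z) * (z.2 * gauss z.2))) +i* 0.
Proof.
rewrite /phi_test partial_trig_gauss; last 3 first.
- exact: trig_poly_phi_quad.
- exact: trig_poly_phi_amp.
- exact: trig_poly_cst.
rewrite /trig_gauss expR_phi_quad derive_phi_amp derive_phi_quad derive_cst !(mul0r, subr0).
by congr (_ +i* _); rewrite /phi_amp /dprofile /profile; ring.
Qed.

Lemma d_x_phi_test z :
  d_x phi_test z = (gauss_mass * (eps * dprofile (y z) * gauss z.2)) +i* 0.
Proof. by rewrite /d_x partial_phi_test /=; congr (_ +i* _); ring. Qed.

Lemma d_t_phi_test z : d_t phi_test z =
  (gauss_mass * (- (c * eps * dprofile (y z)) * gauss z.2 -
    profile (y z) * (z.2 * gauss z.2))) +i* 0.
Proof. by rewrite /d_t partial_phi_test /=; congr (_ +i* _); ring. Qed.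

(* Real and imaginary parts of [(u + i v) e^(- i x)]. *)
Definition phase_re (x : R) : R := u * cos x + v * sin x.

Definition phase_im (x : R) : R := v * cos x - u * sin x.

Hypothesis i2 : (i <= 2)%N.
(** With [phase_im0] this says that the Fourier transform of [(u + i v) x^i gauss x] is the real
    function [gauss_mass * dprofile]. It is verified later for [i = 2] and for [i = 1]. *)
Hypothesis phase_re_dprofile : forall a,
  \int[mu]_x (x ^+ i * phase_re (a * x) * gauss x) = gauss_mass * dprofile a.
Hypothesis phase_im0 : forall a, \int[mu]_x (x ^+ i * phase_im (a * x) * gauss x) = 0.

Lemma integrable_lin_trig_gauss (r s a : R) :
  intg (fun x => x ^+ i * (r * cos (a * x) + s * sin (a * x)) * gauss x).
Proof.
have ic := @integrable_trig_gauss R cos i a (@continuous_cos R) (@cos_max R) i2.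
have is1 := @integrable_trig_gauss R sin i a (@continuous_sin R) (@sin_max R) i2.
apply: eq_integrable (integrableD measurableT
  (integrableZl measurableT r ic) (integrableZl measurableT s is1)) => // x _ /=.
by rewrite -!EFinM -EFinD; congr EFin; ring.
Qed.

Let integrable_rescale (h : R -> R) (a : R) :
  intg (fun x => x ^+ i * h (eps * a * x) * gauss x) ->
  intg (fun x => (x / eps) ^+ i * h (a * x) * gauss (x / eps)).
Proof.
move=> ih; have e0 : eps != 0 by rewrite gt_eqF.
have := integrable_affine 0 (invr_neq0 e0) ih; apply: eq_integrable => // x _ /=.
by rewrite addr0 [eps^-1 * x]mulrC (_ : eps * a * (x / eps) = a * x)//; field.
Qed.

Let Rintegral_rescale (h : R -> R) (a : R) :
  intg (fun x => x ^+ i * h (eps * a * x) * gauss x) ->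
  \int[mu]_x ((x / eps) ^+ i * h (a * x) * gauss (x / eps)) =
  eps * \int[mu]_x (x ^+ i * h (eps * a * x) * gauss x).
Proof.
move=> ih; have e0 : eps != 0 by rewrite gt_eqF.
rewrite (Rintegral_affine 0 e0 (integrable_rescale ih)) gtr0_norm//; congr (_ * _).
apply: eq_Rintegral => x _; rewrite addr0 [eps * x]mulrC mulfK//.
by rewrite (_ : a * (x * eps) = eps * a * x)//; ring.
Qed.

(** The phase of [psi_test] turns [e^(- i x xi)] into [e^(- i (x - c t) xi)]; rescaling by [eps]
    then leads to the two hypotheses at [a = eps (x - c t)]. This brings [d_x phi_test] into the
    form on which the definition of [T] has a grip. *)
Lemma fourier_x_psi_test : fourier_x psi_test = d_x phi_test.
Proof.
apply/funext => z; rewrite d_x_phi_test /fourier_x /fourier /cintegral.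
have expQ x : expR (- psi_quad (x, z.2)) = gauss (x / eps) * gauss z.2.
  by rewrite /psi_quad opprD expRD.
have ReE x : complex.Re (psi_test (x, z.2) * (cos (x * z.1) -i* sin (x * z.1))) =
    gauss z.2 * ((x / eps) ^+ i * phase_re ((z.1 - c * z.2) * x) * gauss (x / eps)).
  rewrite /psi_test /trig_gauss expQ /= /psi_re /psi_im /= /phase_re mulrBl (mulrC z.1 x).
  by rewrite cosB sinB; ring.
have ImE x : complex.Im (psi_test (x, z.2) * (cos (x * z.1) -i* sin (x * z.1))) =
    gauss z.2 * ((x / eps) ^+ i * phase_im ((z.1 - c * z.2) * x) * gauss (x / eps)).
  rewrite /psi_test /trig_gauss expQ /= /psi_re /psi_im /= /phase_im mulrBl (mulrC z.1 x).
  by rewrite cosB sinB; ring.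
have itau a : intg (fun x => x ^+ i * phase_re (a * x) * gauss x).
  exact: integrable_lin_trig_gauss.
have isig a : intg (fun x => x ^+ i * phase_im (a * x) * gauss x).
  have := integrable_lin_trig_gauss v (- u) a; apply: eq_integrable => // x _ /=.
  by rewrite mulNr.
under eq_Rintegral do rewrite ReE.
under [X in _ +i* X]eq_Rintegral do rewrite ImE.
rewrite RintegralZl//; last exact: integrable_rescale.
rewrite RintegralZl//; last exact: integrable_rescale.
rewrite !Rintegral_rescale// phase_re_dprofile phase_im0 !mulr0 /y.
by congr (_ +i* _); ring.
Qed.

Lemma integrable_mul_bounded (h k : R -> R) (B : R) : intg h ->
  measurable_fun [set: R] k -> (forall x, `|k x| <= B) -> intg (fun x => h x * k x).
Proof.
move=> ih mk kB.
have iB : intg (fun x => B * `|h x|).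
  have ihn := integrable_norm ih.
  exact: (integrable_scale _ ihn).
apply: (le_integrable measurableT _ _ iB).
  apply/measurable_EFinP; apply: measurable_funM => //.
  by have /measurable_EFinP := measurable_int _ ih.
move=> x _ /=; rewrite lee_fin normrM mulrC (le_trans _ (ler_norm _))//.
by rewrite ler_wpM2r.
Qed.

Lemma poly_gauss_bounded (h : R -> R) (K : R) (N : nat) :
  (forall x, `|h x| <= K * (1 + x ^+ 2) ^+ N) -> exists B, forall x, `|h x * gauss x| <= B.
Proof.
move=> hK; exists (`|K| * (4 ^+ N * N`!%:R * expR (1 / 4))) => x.
rewrite normrM (ger0_norm (gauss_ge0 x)).
apply: (@le_trans _ _ (`|K| * ((1 + x ^+ 2) ^+ N * gauss x))).
  rewrite mulrA ler_wpM2r ?gauss_ge0// (le_trans (hK x))// ler_wpM2r ?ler_norm//.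
  by rewrite exprn_ge0// addr_ge0 ?sqr_ge0.
rewrite ler_wpM2l// (le_trans (poly_growth_gauss N x))// ler_piMr ?gauss_fun_le1//.
Qed.

Lemma dprofile_bounded : exists B, forall x, `|dprofile x| <= B.
Proof.
apply: (@poly_gauss_bounded _ (2 * `|b| + `|d|) 1) => x; rewrite expr1.
have x2 := sqr_ge0 x.
rewrite (_ : b - x * (b * x + d) = b + (- (b * x ^+ 2) - d * x)); last by ring.
rewrite (le_trans (ler_normD _ _))//.
apply: le_trans (_ : _ <= `|b| + (`|b| * x ^+ 2 + `|d| * `|x|)) _.
  rewrite lerD2l (le_trans (ler_normB _ _))// normrN.
  by rewrite (normrM b) (normrM d) (ger0_norm x2).
have b0 := normr_ge0 b; have d0 := normr_ge0 d.
have := ler_wpM2l d0 (ler_norm_1Dsqr x).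
have := mulr_ge0 b0 x2; lra.
Qed.

Lemma profile_bounded : exists B, forall x, `|profile x| <= B.
Proof.
apply: (@poly_gauss_bounded _ (`|b| + `|d|) 1) => x; rewrite expr1.
have x2 := sqr_ge0 x.
rewrite (le_trans (ler_normD _ _))// normrM.
have b0 := normr_ge0 b; have d0 := normr_ge0 d.
have := ler_wpM2l b0 (ler_norm_1Dsqr x).
have := mulr_ge0 d0 x2; lra.
Qed.

Lemma measurable_dprofile : measurable_fun [set: R] dprofile.
Proof.
apply: measurable_funM; last exact: measurable_gauss.
apply: measurable_funB => //; apply: measurable_funM => //.
by apply: measurable_funD => //; exact: measurable_funM.
Qed.

Lemma measurable_profile : measurable_fun [set: R] profile.
Proof.
apply: measurable_funM; last exact: measurable_gauss.
by apply: measurable_funD => //; exact: measurable_funM.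
Qed.

Lemma continuous_phase_re : continuous phase_re.
Proof.
move=> x; apply: cvgD; apply: cvgM; try exact: cvg_cst.
  exact: continuous_cos.
exact: continuous_sin.
Qed.

Lemma phase_re_bounded x : `|phase_re x| <= `|u| + `|v|.
Proof.
rewrite (le_trans (ler_normD _ _))// !normrM lerD// ler_piMr// ?cos_max ?sin_max//.
Qed.

(** For real [g], the real part of [(u + i v) F[g](xi)]. *)
Definition phase_transform (g : R -> R) (xi : R) : R := \int[mu]_x (g x * phase_re (xi * x)).

Lemma integrable_mul_phase_re (g : R -> R) (xi : R) : intg g ->
  intg (fun x => g x * phase_re (xi * x)).
Proof.
move=> ig; apply: (@integrable_mul_bounded _ _ (`|u| + `|v|)) => //.
  apply: measurableT_comp; last exact: measurable_funM.
  by apply: continuous_measurable_fun; exact: continuous_phase_re.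
by move=> x; exact: phase_re_bounded.
Qed.

Lemma continuous_phase_transform (g : R -> R) : intg g -> continuous (phase_transform g).
Proof.
move=> ig xi.
have igB : intg (fun x => (`|u| + `|v|) * `|g x|).
  have ign := integrable_norm ig.
  exact: (integrable_scale _ ign).
have ct (x : R) : continuous (fun z : R => g x * phase_re (z * x)).
  have ctx : continuous (phase_re \o (fun z : R => z * x)).
    by move=> z; apply: continuous_comp; [exact: mulrr_continuous|exact: continuous_phase_re].
  by move=> z; apply: cvgM; [exact: cvg_cst|exact: ctx].
apply: (@continuity_under_integral R _ _ mu (fun xi x => g x * phase_re (xi * x)) setT measurableT
  (xi - 1) (xi + 1) _ _ (fun x => (`|u| + `|v|) * `|g x|) igB).
- by move=> z _; exact: integrable_mul_phase_re.
- by apply: aeW => x _ z _; exact: ct.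
- by move=> z _; apply: aeW => x _; rewrite normrM mulrC ler_wpM2r// phase_re_bounded.
- by rewrite inE /= in_itv /= ltrBlDr ltrDl ltr01.
Qed.

Lemma phase_transform_bounded (g : R -> R) : intg g ->
  exists B, forall xi, `|phase_transform g xi| <= B.
Proof.
move=> ig; exists ((`|u| + `|v|) * \int[mu]_x `|g x|) => xi.
have igt := integrable_mul_phase_re xi ig.
apply: (le_trans (le_normr_Rintegral measurableT igt)).
have ign := integrable_norm ig.
have igB : intg (fun x => (`|u| + `|v|) * `|g x|).
  exact: (integrable_scale _ ign).
rewrite -RintegralZl//; apply: le_Rintegral => //; first exact: integrable_norm.
by move=> x _; rewrite normrM mulrC ler_wpM2r// phase_re_bounded.
Qed.

(** * The symbol [|xi|^alpha] and the equation tested on [phi_test] *)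

Variable alpha : R.
Hypotheses (alpha0 : 0 < alpha) (alpha2 : alpha < 2).

Lemma measurable_abs_powR : measurable_fun [set: R] (fun x : R => `|x| `^ alpha).
Proof. by apply: (@measurable_comp _ _ _ _ _ _ setT (fun x : R => x `^ alpha)). Qed.

(** The symbol times the [xi]-profile of [psi_test], in the rescaled frequency [x = xi / eps] and
    without the factor [eps^alpha]. *)
Definition riesz_weight (x : R) : R := `|x| `^ alpha * x ^+ i * gauss x.

Lemma powR_abs_le (x : R) : `|x| `^ alpha <= 1 + x ^+ 2.
Proof.
have [x1|/ltW x1] := lerP `|x| 1.
  apply: (@le_trans _ _ 1); last by rewrite lerDl sqr_ge0.
  have <- : 1 `^ alpha = 1 :> R by rewrite powR1.
  by rewrite ge0_ler_powR ?nnegrE// ltW.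
apply: (@le_trans _ _ (`|x| ^+ 2)); last first.
  by rewrite real_normK ?num_real// lerDr.
by rewrite -powR_mulrn// ler_powR// ltW.
Qed.

Lemma integrable_riesz_weight_moment (k : nat) : intg (fun x => riesz_weight x * x ^+ k).
Proof.
have := @integrable_mul_gauss R (fun x => `|x| `^ alpha * x ^+ i * x ^+ k) 1 (1 + i + k).
have -> : (fun x => `|x| `^ alpha * x ^+ i * x ^+ k * gauss x) = (fun x => riesz_weight x * x ^+ k).
  by apply/funext => x; rewrite /riesz_weight; ring.
apply.
  apply: measurable_funM; last exact: measurable_funX.
  apply: measurable_funM; last exact: measurable_funX.
  exact: measurable_abs_powR.
move=> x; rewrite mul1r !normrM !normrX !exprD expr1.
have x1 : 0 <= 1 + x ^+ 2 by rewrite addr_ge0 ?sqr_ge0.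
have pw j : `|x| ^+ j <= (1 + x ^+ 2) ^+ j.
  by rewrite lerXn2r ?nnegrE// ler_norm_1Dsqr.
rewrite ler_pM ?mulr_ge0 ?exprn_ge0// ler_pM ?exprn_ge0//.
by rewrite ger0_norm ?powR_ge0// powR_abs_le.
Qed.

Lemma integrable_riesz_weight_phase_transform (g : R -> R) (a : R) : intg g ->
  intg (fun x => riesz_weight x * phase_transform g (a * x)).
Proof.
move=> ig; have [B PB] := phase_transform_bounded ig.
apply: (@integrable_mul_bounded _ _ B).
- have := integrable_riesz_weight_moment 0; apply: eq_integrable => // x _ /=.
  by rewrite expr0 mulr1.
- apply: measurableT_comp; last exact: measurable_funM.
  by apply: continuous_measurable_fun; exact: continuous_phase_transform.
- by move=> x; exact: PB.
Qed.

Lemma integrable_mul_trig (g t : R -> R) (xi : R) : intg g -> continuous t ->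
  (forall x, `|t x| <= 1) -> intg (fun x => g x * t (xi * x)).
Proof.
move=> ig ct t1; apply: (@integrable_mul_bounded _ _ 1) => //.
apply: measurableT_comp; last exact: measurable_funM.
exact: continuous_measurable_fun.
Qed.

Lemma phase_transformE (g : R -> R) (xi : R) : intg g -> phase_transform g xi =
  u * (\int[mu]_x (g x * cos (xi * x))) + v * \int[mu]_x (g x * sin (xi * x)).
Proof.
move=> ig.
have ic := integrable_mul_trig xi ig (@continuous_cos R) (@cos_max R).
have is1 := integrable_mul_trig xi ig (@continuous_sin R) (@sin_max R).
have iuc : intg (fun x => u * (g x * cos (xi * x))).
  exact: (integrable_scale _ ic).
have ivs : intg (fun x => v * (g x * sin (xi * x))).
  exact: (integrable_scale _ is1).
rewrite /phase_transform -RintegralZl// -RintegralZl// -RintegralD//.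
by apply: eq_Rintegral => x _; rewrite /phase_re; ring.
Qed.

(** Translation by [c t] multiplies the transform of [g] by [e^(- i c t xi)], which is exactly what
    the phase of [psi_test] cancels. What remains is a product of a function of [xi] and a function
    of [t]. *)
Lemma Re_fourier_psi_test (g : R -> R) (z : plane) : intg g ->
  complex.Re (fourier_x (fun z => (g (z.1 - c * z.2))%:C) z * psi_test z) =
  phase_transform g z.1 * ((z.1 / eps) ^+ i * gauss (z.1 / eps) * gauss z.2).
Proof.
move=> ig; rewrite phase_transformE//.
pose Cg := \int[mu]_x (g x * cos (z.1 * x)).
pose Sg := \int[mu]_x (g x * sin (z.1 * x)).
have ic := integrable_mul_trig z.1 ig (@continuous_cos R) (@cos_max R).
have is1 := integrable_mul_trig z.1 ig (@continuous_sin R) (@sin_max R).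
have lin (r s : R) : intg (fun x => r * (g x * cos (z.1 * x)) + s * (g x * sin (z.1 * x))) /\
    \int[mu]_x (r * (g x * cos (z.1 * x)) + s * (g x * sin (z.1 * x))) = r * Cg + s * Sg.
  split.
    exact: (integrable_add (integrable_scale r ic) (integrable_scale s is1)).
  by rewrite RintegralD ?RintegralZl//; exact: integrable_scale.
set th := c * z.2 * z.1.
have ReF : \int[mu]_x complex.Re ((g (x - c * z.2))%:C * (cos (x * z.1) -i* sin (x * z.1))) =
    cos th * Cg + - sin th * Sg.
  have [il el] := lin (cos th) (- sin th).
  rewrite -el -(Rintegral_shift (- (c * z.2)) il).
  apply: eq_Rintegral => x _ /=.
  have -> : x * z.1 = z.1 * (x - c * z.2) + th by rewrite /th; ring.
  by rewrite cosD; ring.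
have ImF : \int[mu]_x complex.Im ((g (x - c * z.2))%:C * (cos (x * z.1) -i* sin (x * z.1))) =
    - sin th * Cg + - cos th * Sg.
  have [il el] := lin (- sin th) (- cos th).
  rewrite -el -(Rintegral_shift (- (c * z.2)) il).
  apply: eq_Rintegral => x _ /=.
  have -> : x * z.1 = z.1 * (x - c * z.2) + th by rewrite /th; ring.
  by rewrite sinD; ring.
rewrite /fourier_x /fourier /cintegral ReF ImF /psi_test /trig_gauss /=.
rewrite /psi_re /psi_im -/th -/Cg -/Sg.
have -> : expR (- psi_quad z) = gauss (z.1 / eps) * gauss z.2 by rewrite /psi_quad opprD expRD.
set w := (z.1 / eps) ^+ i; set e := gauss _ * gauss _.
transitivity ((u * Cg + v * Sg) * (w * e) * (cos th ^+ 2 + sin th ^+ 2)); first by ring.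
by rewrite cos2Dsin2 mulr1 /e -[w * _ * _]mulrA.
Qed.

Let Re_dist_of (w phi : plane -> R[i]) :
  complex.Re (dist_of w phi) = \int[(mu \x mu)%E]_z complex.Re (w z * phi z).
Proof. by []. Qed.

Variables (m n : nat) (f : R -> R).
Hypotheses (intf : intg f) (intfm : intg (fun x => f x ^+ m))
  (intfn : intg (fun x => f x ^+ n)).

(** The real part of the equation on [phi_test]. Once the [t]-integrals are split off, all three
    terms carry [eps] times the Gaussian integral, which cancels; [eps^alpha] comes from writing the
    symbol in the frequency [xi / eps]. *)
Lemma wave_identity : is_solution m n alpha (fun z => f (z.1 - c * z.2)) ->
  gauss_mass * \int[mu]_x ((f x ^+ m - c * f x) * dprofile (eps * x)) =
  eps `^ alpha * \int[mu]_x (riesz_weight x * phase_transform (fun x => f x ^+ n) (eps * x)).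
Proof.
move=> [T [[_ Triesz] eqn]].
have e0 : eps != 0 by rewrite gt_eqF.
pose Th : R := \int[mu]_t gauss t.
have Th0 : 0 < Th by exact: gauss_mass_gt0.
have ith := @integrable_gauss R.
have ith' : intg (fun t => t * gauss t).
  have := @integrable_mul_gauss R id 1 1; apply => // x.
  by rewrite mul1r expr1 ler_norm_1Dsqr.
(* This removes the part of [d_t phi_test] where the derivative falls on [gauss t]; only the
   transport term with factor [c] survives. *)
have Th'0 : \int[mu]_t (t * gauss t) = 0.
  by apply: Rintegral_odd => // t; rewrite gaussN mulNr.
have [B1 hB1] := dprofile_bounded; have [B2 hB2] := profile_bounded.
have mM : measurable_fun [set: R] (fun x => eps * x) by exact: measurable_funM.
have igam h : intg h -> intg (fun x => h x * dprofile (eps * x)).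
  move=> ih; apply: (@integrable_mul_bounded _ _ B1) => //.
  by apply: measurableT_comp => //; exact: measurable_dprofile.
have iGam h : intg h -> intg (fun x => h x * profile (eps * x)).
  move=> ih; apply: (@integrable_mul_bounded _ _ B2) => //.
  by apply: measurableT_comp => //; exact: measurable_profile.
pose I1 := \int[mu]_x (f x * dprofile (eps * x)).
pose Im := \int[mu]_x (f x ^+ m * dprofile (eps * x)).
pose I3 := \int[mu]_x (riesz_weight x * phase_transform (fun x => f x ^+ n) (eps * x)).
have E1 : complex.Re (dist_of (fun z => (f (z.1 - c * z.2))%:C) (d_t phi_test)) =
    - (gauss_mass * (c * eps)) * I1 * Th.
  rewrite Re_dist_of.
  pose G1 (x : R) : R := - (gauss_mass * (c * eps)) * (f x * dprofile (eps * x)).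
  pose G2 (x : R) : R := - gauss_mass * (f x * profile (eps * x)).
  have iG1 : intg G1 by apply: integrable_scale; exact: igam.
  have iG2 : intg G2 by apply: integrable_scale; exact: iGam.
  transitivity (\int[(mu \x mu)%E]_z (G1 (z.1 - c * z.2) * gauss z.2 +
      G2 (z.1 - c * z.2) * (z.2 * gauss z.2))).
    by apply: eq_Rintegral => z _; rewrite d_t_phi_test /= /G1 /G2 /y; ring.
  rewrite RintegralD//; last 2 first.
  - exact: integrable_shear_prod.
  - exact: (integrable_shear_prod c iG2 ith').
  rewrite Rintegral_shear_prod// (Rintegral_shear_prod c iG2 ith') Th'0 mulr0 addr0.
  by rewrite /G1 RintegralZl//; exact: igam.
have E2 : complex.Re (dist_of (fun z => (f (z.1 - c * z.2) ^+ m)%:C) (d_x phi_test)) =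
    gauss_mass * eps * Im * Th.
  rewrite Re_dist_of.
  pose G1 (x : R) : R := gauss_mass * eps * (f x ^+ m * dprofile (eps * x)).
  have iG1 : intg G1 by apply: integrable_scale; exact: igam.
  transitivity (\int[(mu \x mu)%E]_z (G1 (z.1 - c * z.2) * gauss z.2)).
    by apply: eq_Rintegral => z _; rewrite d_x_phi_test /= /G1 /y; ring.
  rewrite Rintegral_shear_prod//.
  by rewrite /G1 RintegralZl//; exact: igam.
have E3 : complex.Re (T (d_x phi_test)) = eps * (eps `^ alpha * I3) * Th.
  (* [T] becomes computable here: its argument is rewritten as a Fourier transform, where its values
     are prescribed. *)
  rewrite -fourier_x_psi_test -[T _]/(dist_fourier_x T psi_test).
  rewrite Triesz; last exact: schwartz_psi_test.
  rewrite Re_dist_of.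
  pose G1 (x : R) : R := eps `^ alpha *
    (riesz_weight (x / eps) * phase_transform (fun x => f x ^+ n) x).
  have ig3 := integrable_riesz_weight_phase_transform eps intfn.
  have ig1 : intg (fun x => riesz_weight (x / eps) * phase_transform (fun x => f x ^+ n) x).
    have := integrable_affine 0 (invr_neq0 e0) ig3; apply: eq_integrable => // x _ /=.
    by rewrite addr0 mulVKf// [eps^-1 * x]mulrC.
  have iG1 : intg G1 by exact: integrable_scale.
  have absE x : `|x| `^ alpha = eps `^ alpha * `|x / eps| `^ alpha.
    rewrite -powRM ?(ltW eps0)//; congr (_ `^ _).
    by rewrite normrM normfV (gtr0_norm eps0) mulrCA mulfV// mulr1.
  (* The phases have cancelled, so no shear is left on the Fourier side: the product formula is used
     with speed [0]. *)
  transitivity (\int[(mu \x mu)%E]_z (G1 (z.1 - 0 * z.2) * gauss z.2)).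
    apply: eq_Rintegral => z _; rewrite -mulrA.
    transitivity (`|z.1| `^ alpha * complex.Re (fourier_x
        (fun z => (f (z.1 - c * z.2) ^+ n)%:C) z * psi_test z)).
      by move: (_ * psi_test z) => [r s] /=; rewrite mul0r subr0.
    by rewrite (Re_fourier_psi_test z intfn) absE /G1 /riesz_weight mul0r subr0; ring.
  rewrite (Rintegral_shear_prod 0 iG1 ith) /G1 RintegralZl//; congr (_ * _).
  rewrite (Rintegral_affine 0 e0 ig1) (gtr0_norm eps0) mulrCA; congr (_ * (_ * _)).
  by apply: eq_Rintegral => x _; rewrite addr0 [eps * x / eps]mulrAC mulfV// mul1r.
have {}eqn := eqn phi_test schwartz_phi_test.
have comb (r s w : R[i]) (r1 s1 w1 : R) : - r - s - - w = 0 -> complex.Re r = r1 ->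
    complex.Re s = s1 -> complex.Re w = w1 -> - r1 - s1 + w1 = 0.
  case: r s w => [r r'] [s s'] [w w'] /eqP; rewrite eq_complex /= => /andP[/eqP h _] <- <- <-.
  by rewrite -[RHS]h; ring.
move: eqn; rewrite /dist_dt /dist_dx => eqn.
have eq0 := comb _ _ _ _ _ _ eqn E1 E2 E3.
have intE : \int[mu]_x ((f x ^+ m - c * f x) * dprofile (eps * x)) = Im - c * I1.
  have i1 := igam _ intfm; have i2' := integrable_scale c (igam _ intf).
  rewrite /Im /I1 -RintegralZl ?igam// -RintegralB//.
  by apply: eq_Rintegral => x _; ring.
rewrite intE -/I3.
have Te : Th * eps != 0 by rewrite mulf_neq0// gt_eqF.
apply: (mulfI Te); apply/eqP; rewrite -subr_eq0; apply/eqP.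
by rewrite -[RHS]oppr0 -eq0; ring.
Qed.

End test_functions.

(** * Travelling waves *)

Section travelling_wave.
Context {R : realType}.
Local Notation mu := (@lebesgue_measure R).
Local Notation intg f := (mu.-integrable [set: R] (EFin \o f)).

(** The right side has coefficients [t j] times a moment of [g] times the moment of [riesz_weight]
    of order [2j + p], and all these products vanish. As [i + p = 2], the last factor integrates
    [|x|^al x^(2j + 2) gauss x], which is positive off [0]; so the moment of [g] must be zero. *)
Lemma vanishing_moments_parity (al b d u v : R) (i p : nat) (t s : nat -> R) (F g : R -> R) :
  0 < al < 2 -> (i + p = 2)%N ->
  has_expansion p (phase_re u v) t -> (forall j, t j != 0) ->
  has_expansion p (dprofile b d) s ->
  (forall k, intg (fun x => F x * x ^+ k)) -> (forall k, intg (fun x => g x * x ^+ k)) ->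
  (forall e, 0 < e -> \int[mu]_x (F x * dprofile b d (e * x)) =
     e `^ al * \int[mu]_x (riesz_weight i al x * phase_transform u v g (e * x))) ->
  forall j, \int[mu]_x (g x * x ^+ (j.*2 + p)) = 0.
Proof.
move=> al02 ip taut t0 gams iF ig eqn j.
have /andP[al0 al2] := al02.
have ig0 : intg g.
  by have := ig 0%N; apply: eq_integrable => // x _ /=; rewrite expr0 mulr1.
have mtau : measurable_fun [set: R] (phase_re u v).
  by apply: continuous_measurable_fun; exact: continuous_phase_re.
have mPhi : measurable_fun [set: R] (phase_transform u v g).
  by apply: continuous_measurable_fun; exact: continuous_phase_transform.
have iw := integrable_riesz_weight_moment i al0 al2.
have e1 := has_expansion_integral iF (measurable_dprofile b d) gams.
have ePhi : has_expansion p (phase_transform u v g) _ := has_expansion_integral ig mtau taut.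
have e2 := has_expansion_integral iw mPhi ePhi.
have [_ /eqP] := has_expansion_powR_eq0 al02 e1 e2 eqn j.
rewrite !mulf_eq0 (negbTE (t0 j)) /= => /orP[/eqP//|].
rewrite gt_eqF//.
have wE x : riesz_weight i al x * x ^+ (j.*2 + p) = `|x| `^ al * (x ^+ 2) ^+ j.+1 * gauss x.
  rewrite /riesz_weight -exprM mulnS mul2n -ip.
  by rewrite !exprD; ring.
apply: Rintegral_gt0 => //.
  move=> x; rewrite wE; apply: mulr_ge0; last exact: gauss_ge0.
  by apply: mulr_ge0; [exact: powR_ge0|rewrite exprn_ge0// sqr_ge0].
move=> x x0; rewrite wE; apply: mulr_gt0; last exact: gauss_gt0.
apply: mulr_gt0; first by rewrite powR_gt0// normr_gt0.
by rewrite exprn_gt0// exprn_even_gt0.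
Qed.

Lemma Rintegral_ae_eq (h k : R -> R) : measurable_fun [set: R] h ->
  measurable_fun [set: R] k -> {ae mu, forall x, h x = k x} ->
  \int[mu]_x h x = \int[mu]_x k x.
Proof.
move=> mh mk hk; rewrite /Rintegral; congr fine; apply: ae_eq_integral => //.
- by apply/measurable_EFinP.
- by apply/measurable_EFinP.
- apply: filterS hk; first exact: (ae_filter_ringOfSetsType mu).
  by move=> x /= ->.
Qed.

Lemma integrable_ae_eq (h k : R -> R) : measurable_fun [set: R] k ->
  {ae mu, forall x, h x = k x} -> intg h -> intg k.
Proof.
move=> mk hk /integrableP[mh ih]; apply/integrableP; split; first by apply/measurable_EFinP.
move: ih; rewrite (@ae_eq_integral _ _ _ mu setT (fun x => `|(EFin \o k) x|)%E)//.
- by apply: measurableT_comp.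
- by apply: measurableT_comp => //; apply/measurable_EFinP.
- apply: filterS hk; first exact: (ae_filter_ringOfSetsType mu).
  by move=> x /= ->.
Qed.

Section wave.
Variables (m n : nat) (al c : R) (f F g : R -> R).
Hypotheses (al02 : 0 < al < 2) (intf : intg f) (intfm : intg (fun x => f x ^+ m))
  (intfn : intg (fun x => f x ^+ n)).
Hypothesis hsol : is_solution m n al (fun z : R * R => f (z.1 - c * z.2)).
(** [F] and [g] represent [gauss_mass (f^m - c f)] and [f^n]. They are kept apart from [f] because
    the equation speaks of [f], while a support bounded at every point is available only after a
    change on a null set. *)
Hypotheses (iF : forall k, intg (fun x => F x * x ^+ k))
  (ig : forall k, intg (fun x => g x * x ^+ k)).
Hypotheses (mF : measurable_fun [set: R] F) (mg : measurable_fun [set: R] g).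
Hypothesis F_ae : {ae mu, forall x, F x = gauss_mass * (f x ^+ m - c * f x)}.
Hypothesis g_ae : {ae mu, forall x, g x = f x ^+ n}.

Lemma wave_vanishing_moments (b d u v : R) (i p : nat) (t s : nat -> R) :
  (i + p = 2)%N -> (i <= 2)%N ->
  (forall a, \int[mu]_x (x ^+ i * phase_re u v (a * x) * gauss x) = gauss_mass * dprofile b d a) ->
  (forall a, \int[mu]_x (x ^+ i * phase_im u v (a * x) * gauss x) = 0) ->
  has_expansion p (phase_re u v) t -> (forall j, t j != 0) ->
  has_expansion p (dprofile b d) s ->
  forall j, \int[mu]_x (g x * x ^+ (j.*2 + p)) = 0.
Proof.
move=> ip i2 taugam phase_im0 taut t0 gams.
have /andP[al0 al2] := al02.
apply: (vanishing_moments_parity al02 ip taut t0 gams iF ig) => e e0.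
have mf : measurable_fun [set: R] f by have /measurable_EFinP := measurable_int _ intf.
have mM : measurable_fun [set: R] (fun x => e * x) by exact: measurable_funM.
have mgam : measurable_fun [set: R] (fun x => dprofile b d (e * x)).
  by apply: measurableT_comp => //; exact: measurable_dprofile.
have id := wave_identity e0 i2 taugam phase_im0 al0 al2 intf intfm intfn hsol.
have phase_transformE xi : phase_transform u v g xi = phase_transform u v (fun x => f x ^+ n) xi.
  have mt : measurable_fun [set: R] (fun x => phase_re u v (xi * x)).
    apply: measurableT_comp; last exact: measurable_funM.
    by apply: continuous_measurable_fun; exact: continuous_phase_re.
  apply: Rintegral_ae_eq.
  - exact: measurable_funM.
  - by apply: measurable_funM => //; exact: measurable_funX.
  - apply: filterS g_ae; first exact: (ae_filter_ringOfSetsType mu).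
    by move=> x /= ->.
under [in RHS]eq_Rintegral do rewrite phase_transformE.
rewrite -id.
have [B gB] := dprofile_bounded b d.
have igam h : intg h -> intg (fun x => h x * dprofile b d (e * x)).
  by move=> ih; apply: (@integrable_mul_bounded _ _ _ B).
have icf : intg (fun x => c * f x).
  exact: (integrable_scale _ intf).
have ifF : intg (fun x => f x ^+ m - c * f x).
  exact: (integrable_sub intfm icf).
rewrite -RintegralZl//; last exact: igam.
apply: Rintegral_ae_eq.
- exact: measurable_funM.
- apply: measurable_funM => //; apply: measurable_funM => //.
  apply: measurable_funB; first exact: measurable_funX.
  exact: measurable_funM.
- apply: filterS F_ae; first exact: (ae_filter_ringOfSetsType mu).
  by move=> x /= ->; rewrite mulrA.
Qed.

(** Tested with [xi^2 gauss] on the Fourier side: the profile is [x gauss x], with the even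
    derivative [(1 - x^2) gauss x]. *)
Lemma wave_even_moments j : \int[mu]_x (g x * x ^+ (j.*2 + 0)) = 0.
Proof.
have [s hs] := @has_expansion_gauss2 R.
apply: (@wave_vanishing_moments 1 0 1 0 2 0 cos_coef s) => //.
- move=> a; rewrite /dprofile /phase_re !mul1r addr0 -expr2 -gauss_fourier_cos.
  by apply: eq_Rintegral => x _; rewrite mul0r addr0 mul1r.
- move=> a; apply: Rintegral_odd.
    have := @integrable_trig_gauss R sin 2 a (@continuous_sin R) (@sin_max R) isT.
    move=> /integrableN; apply: eq_integrable => // x _ /=.
    by congr EFin; rewrite /phase_im; ring.
  by move=> x; rewrite /phase_im gaussN (mulrN a) cosN sinN; ring.
- rewrite (_ : phase_re 1 0 = cos); first exact: has_expansion_cos.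
  by apply/funext => x; rewrite /phase_re mul0r mul1r addr0.
- by move=> k; rewrite /cos_coef mulf_neq0 ?signr_eq0// invr_neq0// pnatr_eq0 -lt0n fact_gt0.
- rewrite (_ : dprofile 1 0 = fun y => (1 - y ^+ 2) * gauss y)//.
  by apply/funext => x; rewrite /dprofile mul1r addr0 expr2.
Qed.

(** Tested with [i xi gauss] on the Fourier side: the profile is [- gauss x], with the odd
    derivative [x gauss x]. *)
Lemma wave_odd_moments j : \int[mu]_x (g x * x ^+ (j.*2 + 1)) = 0.
Proof.
have [s hs] := @has_expansion_gauss1 R.
have gamE : dprofile 0 (-1) = fun y : R => y * gauss y.
  by apply/funext => x; rewrite /dprofile; ring.
apply: (@wave_vanishing_moments 0 (-1) 0 1 1 1 sin_coef s) => //.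
- move=> a; rewrite gamE /phase_re -gauss_fourier_sin.
  by apply: eq_Rintegral => x _; rewrite mul0r add0r mul1r.
- move=> a; apply: Rintegral_odd.
    have := @integrable_trig_gauss R cos 1 a (@continuous_cos R) (@cos_max R) isT.
    apply: eq_integrable => // x _ /=.
    by rewrite /phase_im mul0r mul1r subr0.
  by move=> x; rewrite /phase_im gaussN (mulrN a) cosN sinN; ring.
- rewrite (_ : phase_re 0 1 = sin); first exact: has_expansion_sin.
  by apply/funext => x; rewrite /phase_re mul0r mul1r add0r.
- by move=> k; rewrite /sin_coef mulf_neq0 ?signr_eq0// invr_neq0// pnatr_eq0 -lt0n fact_gt0.
- by rewrite gamE.
Qed.

Lemma wave_moments k : \int[mu]_x (g x * x ^+ k) = 0.
Proof.
rewrite -(odd_double_half k); case: (odd k).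
  by rewrite addnC; exact: wave_odd_moments.
by rewrite add0n -[k./2.*2]addn0; exact: wave_even_moments.
Qed.

End wave.

End travelling_wave.

(** * Passage to a representative that is bounded and compactly supported at every point *)

Theorem proposition2p1 (R : realType) (m n : nat) (alpha c : R) (f : R -> R)
  (hm : (0 < m)%N) (hn : (0 < n)%N) (halpha : 0 < alpha < 2)
  (hf1 : f \in Lfun (@lebesgue_measure R) 1%E)
  (hfoo : f \in Lfun (@lebesgue_measure R) +oo%E)
  (hsupp : compactly_supported f)
  (hsol : is_solution m n alpha (fun z : R * R => f (z.1 - c * z.2))) :
  {ae @lebesgue_measure R, forall x, f x = 0}.
Proof.
set mu := @lebesgue_measure R.
have aeF := ae_filter_ringOfSetsType mu.
have intf : mu.-integrable [set: R] (EFin \o f) by apply/Lfun1_integrable.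
have mf : measurable_fun [set: R] f by have /measurable_EFinP := measurable_int _ intf.
have [B fB] : exists B : R, {ae mu, forall x, `|f x| <= B}.
  (* The norm at exponent [+oo] is the essential supremum only when the whole space has positive
     measure. *)
  have muT : (0 < mu [set: R])%E.
    apply: (@lt_le_trans _ _ (mu `]0%R, 1%R]%classic)).
      by rewrite /mu lebesgue_measure_itv /= lte_fin ltr01 oppr0 adde0 lte_fin.
    by apply: le_measure; rewrite ?inE.
  have := sub_Lfun_finLfun hfoo; rewrite inE /= /finite_norm unlock muT => fin.
  have := ess_sup_ge mu (abse \o (EFin \o f)); move: fin.
  case: (ess_sup mu _) => [r _|//|_] fr.
    by exists r; apply: filterS fr => x /=; rewrite lee_fin.
  (* The value [-oo] would force [|f x| <= -oo] almost everywhere, which is absurd pointwise, so any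
     bound follows. *)
  by exists 0; apply: filterS fr => x /=; rewrite leeNy_eq.
have [M fM] : exists M : R, {ae mu, forall x, M < `|x| -> f x = 0}.
  have [K [cK fK]] := hsupp.
  have [M [_ KM]] := compact_bounded cK.
  (* [compact_bounded] bounds [K] by every number strictly above [M]. *)
  exists (M + 1); apply: filterS fK => x fx Mx; apply: fx => Kx.
  have := KM (M + 1); rewrite ltrDl ltr01 => /(_ isT x Kx).
  by rewrite /= leNgt Mx.
(* Truncating in both [x] and the value of [f] alters a null set only. Boundedness makes the powers
   of [h] integrable; the support gives all moments. *)
pose h (x : R) := if (`|x| <= M) && (`|f x| <= B) then f x else 0.
have hf : {ae mu, forall x, h x = f x}.
  apply: filterS2 fB fM => x fxB fxM; rewrite /h fxB andbT.
  by case: lerP => // /fxM ->.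
have mh : measurable_fun [set: R] h.
  apply: measurable_fun_ifT => //.
  by apply: measurable_and; apply: measurable_fun_ler => //; exact: measurableT_comp.
have hM x : M < `|x| -> h x = 0 by rewrite /h ltNge => /negbTE ->.
have hB x : `|h x| <= `|B|.
  rewrite /h; case: ifPn => [/andP[_ /le_trans]|_]; last by rewrite normr0.
  by apply; exact: ler_norm.
have ih : mu.-integrable [set: R] (EFin \o h).
  apply: (le_integrable measurableT _ _ intf); first by apply/measurable_EFinP.
  by move=> x _ /=; rewrite lee_fin /h; case: ifPn => // _; rewrite normr0.
have ihk k : (0 < k)%N -> mu.-integrable [set: R] (EFin \o (fun x => h x ^+ k)).
  case: k => // k _.
  have hBk x : `|h x ^+ k| <= `|B| ^+ k by rewrite normrX lerXn2r ?nnegrE.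
  have mhk : measurable_fun [set: R] (fun x => h x ^+ k) by exact: measurable_funX.
  have := integrable_mul_bounded ih mhk hBk.
  by apply: eq_integrable => // x _ /=; rewrite exprS.
have ifk k : (0 < k)%N -> mu.-integrable [set: R] (EFin \o (fun x => f x ^+ k)).
  move=> k0; apply: (@integrable_ae_eq R (fun x => h x ^+ k)); last exact: ihk.
    exact: measurable_funX.
  by apply: filterS hf => x ->.
have moment (G : R -> R) : mu.-integrable [set: R] (EFin \o G) ->
    (forall x, M < `|x| -> G x = 0) ->
    forall k, mu.-integrable [set: R] (EFin \o (fun x => G x * x ^+ k)).
  move=> iG GM k; apply: (@integrable_mul_bounded_on R G M iG GM _ (`|M| ^+ k)).
    exact: measurable_funX.
  move=> x xM; rewrite normrX lerXn2r ?nnegrE//.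
  by rewrite (le_trans xM)// ler_norm.
pose F (x : R) := gauss_mass * (h x ^+ m - c * h x).
have iF : mu.-integrable [set: R] (EFin \o F).
  have ich : mu.-integrable [set: R] (EFin \o (fun x => c * h x)).
    exact: (integrable_scale _ ih).
  have id : mu.-integrable [set: R] (EFin \o (fun x => h x ^+ m - c * h x)).
    exact: (integrable_sub (ihk m hm) ich).
  exact: (integrable_scale _ id).
(* The powers inherit the support of [h] because [0^m = 0] for [m > 0], and likewise for [n]. *)
have FM x : M < `|x| -> F x = 0.
  by move=> /hM hx; rewrite /F hx expr0n eqn0Ngt hm /= mulr0 subr0 mulr0.
have gM x : M < `|x| -> h x ^+ n = 0.
  by move=> /hM ->; rewrite expr0n eqn0Ngt hn.
have moments0 := @wave_moments R m n alpha c f F (fun x => h x ^+ n) halpha intf (ifk m hm)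
  (ifk n hn) hsol (moment F iF FM) (moment _ (ihk n hn) gM).
have := vanishing_moments_ae0 (ihk n hn) gM (moments0 _ _ _ _).
move=> hn0.
have {}hn0 : {ae mu, forall x, h x ^+ n = 0}.
  apply: hn0.
  - by have /measurable_EFinP := measurable_int _ iF.
  - exact: measurable_funX.
  - by apply: filterS hf => x hx; rewrite /F hx.
  - by apply: filterS hf => x ->.
apply: filterS2 hf hn0 => x <- /eqP.
by rewrite expf_eq0 hn => /eqP.
Qed.
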